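(* For each of the six triples $S\in\{(P_1,P_2,P_4),\,(P_1,P_2,P_5),\,(P_2,P_3,P_4),\,(P_2,P_3,P_5),\,(P_1,P_4,P_5),\,(P_2,P_4,P_5)\}$, as formal power series in $x$, $$\sum_{n\ge 0}|\mathcal{M}_n(S)|\,x^n=\frac{1-3x+3x^2}{(1-x)^2(1-2x)}.$$
   Context: A matching with $n$ arcs is a partition of $\{1,2,\ldots,2n\}$ into blocks of size 2, called arcs; an arc is written $[a,b]$ with $a<b$, where $a$ is its opener and $b$ its closer. For $n=0$ there is exactly one (empty) matching. A matching is Stoimenow if it contains no pair of arcs $[i,\ell],[i+1,k]$ with $i+1<k<\ell$ (Type 1) and no pair of arcs $[k,j+1],[\ell,j]$ with $k<\ell<j$ (Type 2). A matching $M$ contains a pattern (a matching) $P$ with $m$ arcs if some $m$ arcs of $M$ become $P$ after their $2m$ endpoints are relabelled $1,\ldots,2m$ in the order-preserving way; otherwise $M$ avoids $P$. $\mathcal{M}_n(S)$ denotes the set of Stoimenow matchings with $n$ arcs avoiding every pattern in $S$. The patterns are $P_1=\{[1,3],[2,7],[4,5],[6,8]\}$, $P_2=\{[1,3],[2,5],[4,7],[6,8]\}$, $P_3=\{[1,2],[3,5],[4,6],[7,8]\}$, $P_4=\{[1,2],[3,5],[4,7],[6,8]\}$, $P_5=\{[1,3],[2,5],[4,6],[7,8]\}$. *)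

(* Defs.v *)
From mathcomp Require Import all_boot all_order all_algebra.
Set Implicit Arguments.
Unset Strict Implicit.
Unset Printing Implicit Defensive.
Import GRing.Theory.

(* The points 1, ..., 2n are represented by the ordinals 0, ..., 2n-1 of
   ['I_n.*2]; all notions below depend only on the order of the points and on
   adjacency, so the shift is harmless. *)
Definition is_matching n (M : {set {set 'I_n.*2}}) : bool :=
  partition M [set: 'I_n.*2] && [forall B in M, #|B| == 2].

Definition arc n (M : {set {set 'I_n.*2}}) (a b : 'I_n.*2) : bool :=
  (a < b) && ([set a; b] \in M).

(* Arcs [i, l] and [i', k] with i' = i + 1 and i + 1 < k < l. *)
Definition has_type1 n (M : {set {set 'I_n.*2}}) : bool :=
  [exists i : 'I_n.*2, exists i' : 'I_n.*2,
   exists k : 'I_n.*2, exists l : 'I_n.*2,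
    [&& i' == i.+1 :> nat, k < l, arc M i l & arc M i' k]].

(* Arcs [k, j'] and [l, j] with j' = j + 1 and k < l < j. *)
Definition has_type2 n (M : {set {set 'I_n.*2}}) : bool :=
  [exists j : 'I_n.*2, exists j' : 'I_n.*2,
   exists k : 'I_n.*2, exists l : 'I_n.*2,
    [&& j' == j.+1 :> nat, k < l, arc M k j' & arc M l j]].

Definition stoimenow n (M : {set {set 'I_n.*2}}) : bool :=
  [&& is_matching M, ~~ has_type1 M & ~~ has_type2 M].

(* [A] is the chosen set of [m] arcs of [M]; [f] is the inverse of the
   order-preserving relabelling of the endpoints of [A]. *)
Definition contains n m (M : {set {set 'I_n.*2}})
    (P : {set {set 'I_m.*2}}) : bool :=
  [exists A : {set {set 'I_n.*2}}, [&& A \subset M, #|A| == m &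
    [exists f : {ffun 'I_m.*2 -> 'I_n.*2},
      [forall x : 'I_m.*2, forall y : 'I_m.*2, (x < y) ==> (f x < f y)] &&
      (A == [set f @: (B : {set 'I_m.*2}) | B in P])]]].

Definition avoids n m (M : {set {set 'I_n.*2}})
    (P : {set {set 'I_m.*2}}) : bool := ~~ contains M P.

Definition stoimenow_avoiders n m (S : seq {set {set 'I_m.*2}}) :
    {set {set {set 'I_n.*2}}} :=
  [set M | stoimenow M && all (avoids M) S].

(* Arcs are given by their endpoints in {1, ..., 2m}. *)
Definition pattern m (s : seq (nat * nat)) : {set {set 'I_m.*2}} :=
  [set:: [seq [set x : 'I_m.*2 | (x.+1 == e.1) || (x.+1 == e.2)] | e <- s]].

Definition P1 := pattern 4 [:: (1, 3); (2, 7); (4, 5); (6, 8)].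
Definition P2 := pattern 4 [:: (1, 3); (2, 5); (4, 7); (6, 8)].
Definition P3 := pattern 4 [:: (1, 2); (3, 5); (4, 6); (7, 8)].
Definition P4 := pattern 4 [:: (1, 2); (3, 5); (4, 7); (6, 8)].
Definition P5 := pattern 4 [:: (1, 3); (2, 5); (4, 6); (7, 8)].

Local Open Scope ring_scope.

(* A series is its sequence of coefficients; equality of series is [=1]. *)
Definition fps (R : Type) := nat -> R.

Definition fps_of_poly (R : nzRingType) (p : {poly R}) : fps R :=
  fun n => p`_n.

Definition fps_mul (R : nzRingType) (a b : fps R) : fps R :=
  fun n => \sum_(i < n.+1) a i * b (n - i)%N.

(* The first [n] coefficients of the inverse, obtained by solving
   [\sum_(i < n.+1) a (n - i) * b i = (n == 0)] for [b n]; meaningful when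
   [a 0] is a unit. *)
Fixpoint fps_inv_coefs (R : comUnitRingType) (a : fps R) (n : nat) : seq R :=
  if n is n'.+1 then
    let s := fps_inv_coefs a n' in
    rcons s ((a 0%N)^-1 * ((n' == 0%N)%:R - \sum_(i < n') a (n' - i)%N * s`_i))
  else [::].

Definition fps_inv (R : comUnitRingType) (a : fps R) : fps R :=
  fun n => (fps_inv_coefs a n.+1)`_n.

Definition fps_div (R : comUnitRingType) (a b : fps R) : fps R :=
  fps_mul a (fps_inv b).

Lemma size_fps_inv_coefs (R : comUnitRingType) (a : fps R) n :
  size (fps_inv_coefs a n) = n.
Proof. by elim: n => //= n IHn; rewrite size_rcons IHn. Qed.

Lemma nth_fps_inv_coefs (R : comUnitRingType) (a : fps R) n i :
  (i < n)%N -> (fps_inv_coefs a n)`_i = fps_inv a i.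
Proof.
elim: n => // n IHn; rewrite ltnS leq_eqVlt => /predU1P[-> // | lt_in].
by rewrite /= nth_rcons size_fps_inv_coefs lt_in IHn.
Qed.

Lemma fps_invE (R : comUnitRingType) (a : fps R) n :
  fps_inv a n =
  (a 0%N)^-1 * ((n == 0%N)%:R - \sum_(i < n) a (n - i)%N * fps_inv a i).
Proof.
rewrite {1}/fps_inv /= nth_rcons size_fps_inv_coefs ltnn eqxx.
by under eq_bigr => i _ do rewrite nth_fps_inv_coefs ?ltn_ord //.
Qed.

Lemma fps_mulrV (R : comUnitRingType) (a : fps R) :
  a 0%N \is a GRing.unit -> fps_mul a (fps_inv a) =1 fps_of_poly 1.
Proof.
move=> Ua n; rewrite /fps_mul /fps_of_poly coef1 (reindex_inj rev_ord_inj) /=.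
under eq_bigr => i _ do rewrite subSS subKn -1?ltnS ?ltn_ord //.
rewrite big_ord_recr /= subnn fps_invE mulrA divrr // mul1r addrC subrK.
by [].
Qed.

Definition avoiders_gf m (S : seq {set {set 'I_m.*2}}) : fps rat :=
  fun n => #|stoimenow_avoiders n S|%:R.

(* Main.v *)
(* A Stoimenow matching is determined by the multiset of the cells (i, j) of its
   arcs, where i and j are the ranks of the run of openers and of the run of
   closers containing the endpoints: these are the nonzero entries of an upper
   triangular k x k matrix without zero row or column. Sorting the cells, a
   matching becomes a list of n cells, and the patterns become conditions on two
   cells (b1, b2) and (d1, d2), e.g. P1 means b1 < d1, d2 < b2 and P2 means
   b1 < d1 <= b2 < d2. The matchings in each class are then explicit: all the
   cells of the diagonal, plus possibly
     - (0, 1) for (P1, P2, P4), and (0, k - 1) for (P2, P4, P5);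
     - copies of the (i, k - 1), the (i, i) with 0 < i < k - 1 being simple,
       for (P2, P3, P5);
   for (P1, P4, P5) either the diagonal, or the first row and the last column
   with or without their common corner. The remaining two triples are the mirror
   images of (P1, P2, P4) and (P2, P3, P5). In all cases the lists of n cells are
   coded by the subsets of {0, ..., n - 1} which are not singletons, and
   2 ^ n - n is the coefficient of the rational function. *)
Require Import Defs.
From mathcomp Require Import all_boot all_order all_algebra.
From mathcomp Require Import zify ring.
Set Implicit Arguments.
Unset Strict Implicit.
Unset Printing Implicit Defensive.
(* [Defs] is imported again because [path] has another [arc]. *)
Import Defs GRing.Theory.

(** * Coefficients of the rational function *)

Section GF.
Local Open Scope ring_scope.

Lemma coef_den (R : comUnitRingType) m : ((1 - 'X) ^+ 2 * (1 - 2%:R *: 'X) : {poly R})`_m =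
  nth 0 [:: 1; -4%:R; 5%:R; -2%:R] m.
Proof.
have -> : (1 - 'X) ^+ 2 * (1 - 2%:R *: 'X) = Poly [:: 1; -4%:R; 5%:R; -2%:R] :> {poly R}.
  rewrite /= !cons_poly_def mul0r add0r -!mul_polyC !polyCN !polyCMn.
  by ring.
by rewrite coef_Poly.
Qed.

Lemma coef_num (R : comUnitRingType) m : (1 - 3%:R *: 'X + 3%:R *: 'X^2 : {poly R})`_m =
  nth 0 [:: 1; -3%:R; 3%:R] m.
Proof.
have -> : 1 - 3%:R *: 'X + 3%:R *: 'X^2 = Poly [:: 1; -3%:R; 3%:R] :> {poly R}.
  rewrite /= !cons_poly_def mul0r add0r -!mul_polyC !polyCN !polyCMn.
  by ring.
by rewrite coef_Poly.
Qed.

(** Partial fractions: the inverse is 4/(1-2x) - 2/(1-x) - 1/(1-x)^2. The induction checks this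
    against the recurrence of order 3 given by the denominator. *)
Lemma fps_inv_den (R : comUnitRingType) n :
  fps_inv (fps_of_poly ((1 - 'X) ^+ 2 * (1 - 2%:R *: 'X) : {poly R})) n =
  2%:R ^+ n.+2 - (n + 3)%:R.
Proof.
elim/ltn_ind: n => n IHn; rewrite fps_invE /fps_of_poly coef_den /= invr1 mul1r.
under eq_bigr => i _ do rewrite (IHn i (ltn_ord i)) coef_den.
case: n IHn => [|[|[|n]]] _.
- by rewrite big_ord0 /=; ring.
- by rewrite !big_ord_recr big_ord0 /=; ring.
- by rewrite !big_ord_recr big_ord0 /=; ring.
(* The denominator has degree 3, so only the last three terms survive. *)
rewrite 3!big_ord_recr /= big1 => [|i _]; last first.
  have -> : (n.+3 - i = (n - i.+1).+4)%N by have := ltn_ord i; lia.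
  by rewrite /= nth_nil mul0r.
have [e3 e2 e1] : [/\ (n.+3 - n = 3)%N, (n.+3 - n.+1 = 2)%N & (n.+3 - n.+2 = 1)%N].
  by split; lia.
by rewrite e3 e2 e1 /= add0r !natrD !exprS -!natr1; ring.
Qed.

Lemma fps_div_coef (R : comUnitRingType) n :
  fps_div (fps_of_poly (1 - 3%:R *: 'X + 3%:R *: 'X^2))
          (fps_of_poly ((1 - 'X) ^+ 2 * (1 - 2%:R *: 'X))) n
  = (2 ^ n - n)%:R :> R.
Proof.
rewrite natrB; last by rewrite ltnW // ltn_expl.
rewrite natrX /fps_div /fps_mul.
under eq_bigr => i _ do rewrite fps_inv_den /fps_of_poly coef_num.
case: n => [|[|n]].
- by rewrite big_ord_recl big_ord0 /= subn0 mulr0n; ring.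
- by rewrite !big_ord_recl big_ord0 /= /bump subnn subn0; ring.
rewrite 3!big_ord_recl big1 => [|i _]; last by rewrite /= nth_nil mul0r.
rewrite /bump /= !subSS !subn0 !exprS !natrD -!natr1.
by ring.
Qed.

End GF.

(** * Matchings and their enumerations *)

Lemma card_ltn_ord m (r : 'I_m) : #|[set p : 'I_m | p < r]| = r.
Proof.
have wi : injective (widen_ord (ltnW (ltn_ord r))).
  by move=> p q /(congr1 val) /= /ord_inj.
rewrite -[RHS]card_ord -(card_imset _ wi); apply: eq_card => p.
rewrite inE; apply/idP/imsetP => [pr|[q _ ->]]; last exact: (ltn_ord q).
by exists (Ordinal pr) => //; apply: ord_inj.
Qed.

(** [o] is [o'] after a self-map [s] of ['I_n]; this map is increasing and bijective, so [s t] and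
    [t] have the same number of smaller elements. *)
Lemma strict_mono_same_image n m (o o' : 'I_n -> 'I_m) :
  (forall s t : 'I_n, s < t -> o s < o t) ->
  (forall s t : 'I_n, s < t -> o' s < o' t) ->
  (forall t, exists t', o t = o' t') -> o =1 o'.
Proof.
move=> mo mo' im t.
have ltE (f : 'I_n -> 'I_m) : (forall s t : 'I_n, s < t -> f s < f t) ->
    forall s t : 'I_n, (f s < f t) = (s < t).
  move=> mf x y; case: (ltngtP x y) => [/mf->//|/mf yx|/ord_inj->]; last by rewrite ltnn.
  by apply/negbTE; rewrite -leqNgt ltnW.
have [s Es] := fin_all_exists im.
have s_inj : injective s.
  move=> x y sxy; apply/ord_inj; case: (ltngtP x y) => // /mo; by rewrite !Es sxy ltnn.
have smono x y : (s x < s y) = (x < y) by rewrite -[RHS](ltE o mo) !Es (ltE o' mo').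
rewrite Es; suff /ord_inj-> : s t = t :> nat by [].
rewrite -(card_ltn_ord (s t)) -[RHS]card_ltn_ord -[RHS](card_imset _ s_inj); apply: eq_card => x.
have [s' _ sK] : bijective s by apply: injF_bij.
rewrite -[x]sK inE smono; apply/idP/imsetP => [lt|[y]]; first by exists (s' x); rewrite ?inE.
by rewrite inE => lt /s_inj ->.
Qed.

Section Enumeration.
Variable n : nat.
Implicit Types (M : {set {set 'I_n.*2}}) (t s : 'I_n).
Let E := ('I_n * bool)%type.
Implicit Types (e : E -> 'I_n.*2).

Definition arcs_of e := [set [set e (t, false); e (t, true)] | t : 'I_n].

(* [e (t, false)] and [e (t, true)] are the opener and the closer of the arc
   number [t]; the arcs are numbered in the order of their openers. *)
Definition enumerates e M :=
  [/\ injective e, forall t, e (t, false) < e (t, true),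
      forall s t, s < t -> e (s, false) < e (t, false) & M = arcs_of e].

Lemma endpoint_card : #|{: E}| = n.*2.
Proof. by rewrite card_prod card_ord card_bool muln2. Qed.

Lemma endpoint_surj e : injective e -> forall p, exists x, e x = p.
Proof.
move=> e_inj p; have [|e' _ eK] := inj_card_bij e_inj.
  by rewrite endpoint_card card_ord.
by exists (e' p).
Qed.

Lemma mem_arcs_of e (B : {set 'I_n.*2}) :
  reflect (exists t, B = [set e (t, false); e (t, true)]) (B \in arcs_of e).
Proof. by apply: (iffP imsetP) => [[t _ ->]|[t ->]]; exists t. Qed.

Lemma is_matching_arcs_of e : injective e -> is_matching (arcs_of e).
Proof.
move=> e_inj; apply/andP; split; last first.
  apply/forall_inP => _ /mem_arcs_of[t ->].
  by rewrite cards2 (inj_eq e_inj) xpair_eqE eqxx.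
apply/and3P; split.
- rewrite eqEsubset subsetT /=; apply/subsetP => p _.
  have [[t b] <-] := endpoint_surj e_inj p.
  apply/bigcupP; exists [set e (t, false); e (t, true)]; first by apply/mem_arcs_of; exists t.
  by rewrite !inE; case: b; rewrite eqxx ?orbT.
- apply/trivIsetP => _ _ /mem_arcs_of[t ->] /mem_arcs_of[s ->] neq.
  rewrite -setI_eq0; apply/eqP/setP => p; rewrite !inE; apply/negP => /andP[].
  by move=> /orP[] /eqP-> /orP[] /eqP /e_inj // [ts]; move: neq; rewrite ts eqxx.
- apply/negP => /mem_arcs_of[t] /setP /(_ (e (t, false))).
  by rewrite !inE eqxx.
Qed.

Lemma arc_arcs_of e a b : (forall t, e (t, false) < e (t, true)) ->
  reflect (exists2 t, a = e (t, false) & b = e (t, true)) (arc (arcs_of e) a b).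
Proof.
move=> lt_e; apply: (iffP andP) => [[ltab /mem_arcs_of[t /setP eqt]]|[t -> ->]]; last first.
  by split; rewrite ?lt_e //; apply/mem_arcs_of; exists t.
exists t; have := eqt a; have := eqt b; rewrite !inE !eqxx orbT /=;
  have := lt_e t; move=> lt /esym/orP[] /eqP eb /esym/orP[] /eqP ea //; subst; lia.
Qed.

(** The blocks determine which points are openers, and both enumerations list these increasingly;
    the closers follow. *)
Lemma enumerates_unique e e' M : enumerates e M -> enumerates e' M -> e =1 e'.
Proof.
move=> [e_inj lt_e mono ->] [e'_inj lt_e' mono' eqM].
have arcE t : exists2 s, e (t, false) = e' (s, false) & e (t, true) = e' (s, true).
  by apply/arc_arcs_of => //; rewrite -eqM; apply/arc_arcs_of => //; exists t.
have eqo : (fun t => e (t, false)) =1 (fun t => e' (t, false)).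
  by apply: strict_mono_same_image => // t; have [s] := arcE t; exists s.
move=> [t []]; last exact: eqo.
by have [s eo ->] := arcE t; move: eo; rewrite (eqo t) => /e'_inj[->].
Qed.

Lemma matching_enumerates M : is_matching M -> exists e, enumerates e M.
Proof.
move=> /andP[partM /forall_inP card2].
have cardM : #|M| = n.
  have := card_uniform_partition (fun B BM => eqP (card2 B BM)) partM.
  by rewrite cardsT card_ord; lia.
have [/eqP covM trivM _] := and3P partM.
have blockE (a : 'I_n.*2) (B : {set 'I_n.*2}) : a \in B -> B \in M -> pblock M a = B.
  by move=> aB BM; apply: def_pblock.
have pairM (B : {set 'I_n.*2}) : B \in M -> exists a b : 'I_n.*2, a < b /\ B = [set a; b].
  move=> BM; have /cards2P[a [b [neq ->]]] := card2 B BM.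
  case: (ltngtP a b) => [lt|lt|/ord_inj eq]; last by rewrite eq eqxx in neq.
    by exists a, b.
  by exists b, a; rewrite setUC.
(* The set of openers has [n] elements because [pblock M] maps it bijectively onto the blocks. *)
pose O := [set a : 'I_n.*2 | [exists b, arc M a b]].
have cardO : #|O| = n.
  apply: etrans cardM; rewrite -(card_in_imset (f := pblock M)).
    apply: eq_card => B; apply/imsetP/idP => [[a]|BM].
      by rewrite inE => /existsP[b /andP[_ abM]] ->; rewrite (blockE _ _ _ abM) // !inE eqxx.
    have [a [b [lt eqB]]] := pairM B BM; exists a.
      by rewrite inE; apply/existsP; exists b; rewrite /arc lt -eqB.
    by rewrite (blockE a B) // eqB !inE eqxx.
  move=> a a'; rewrite !inE => /existsP[b /andP[ltb abM]] /existsP[b' /andP[ltb' abM']].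
  rewrite (blockE _ _ _ abM) ?inE ?eqxx // (blockE _ _ _ abM') ?inE ?eqxx // => /setP eqB.
  have := eqB a; have := eqB a'; rewrite !inE !eqxx /=.
  move=> /orP[/eqP-> //|/eqP e1] /esym/orP[/eqP-> //|/eqP e2].
  by move: ltb ltb'; rewrite -e1 -e2; lia.
have sizeO : size (enum O) = n by rewrite -cardE.
have sortO : sorted ltn [seq val x | x <- enum O].
  (* [enum] follows the order of the ordinals, so the values form a subsequence of [iota]. *)
  have -> : [seq val x | x <- enum O] = filter (fun i => i \in [seq val x | x <- enum O]) (iota 0 n.*2).
    rewrite -val_enum_ord filter_map {1}/enum_mem -enumT; congr map.
    apply: eq_filter => x /=; rewrite mem_map ?mem_enum //; exact: val_inj.
  apply: sorted_filter; [exact: ltn_trans | exact: iota_ltn_sorted].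
have clP (a : 'I_n.*2) : exists b, (a \in O) ==> arc M a b.
  case: (boolP (a \in O)) => [|_]; last by exists a.
  by rewrite inE => /existsP[b ab]; exists b; rewrite ab.
have [cl Hcl] := fin_all_exists clP.
pose o t : 'I_n.*2 := enum_val (cast_ord (esym cardO) t).
have o_mono s t : s < t -> o s < o t.
  move=> st; have [szs szt] : s < size (enum O) /\ t < size (enum O) by rewrite sizeO.
  rewrite /o !(enum_val_nth (o s)) /= -!(nth_map _ 0 val) //.
  by apply: (sorted_ltn_nth ltn_trans) => //; rewrite inE size_map.
have o_arc t : arc M (o t) (cl (o t)) by apply: (implyP (Hcl (o t))); exact: enum_valP.
have o_surj a : a \in O -> exists t, a = o t.
  move=> aO; exists (cast_ord cardO (enum_rank_in aO a)).
  by rewrite /o cast_ordK enum_rankK_in.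
have o_inj s t : o s = o t -> s = t.
  by move=> eq; case: (ltngtP s t) => [/o_mono|/o_mono|/ord_inj //]; rewrite eq ltnn.
have o_blk s t a : a \in [set o s; cl (o s)] -> a \in [set o t; cl (o t)] -> s = t.
  have /andP[lts sM] := o_arc s; have /andP[ltt tM] := o_arc t.
  move=> /blockE/(_ sM) bs /blockE/(_ tM); rewrite bs => /setP eqB; apply: o_inj.
  have := eqB (o s); have := eqB (o t); rewrite !inE !eqxx /=.
  move=> /orP[/eqP-> //|/eqP e1] /esym/orP[/eqP-> //|/eqP e2].
  by move: lts ltt; rewrite -e1 -e2; lia.
exists (fun x => if x.2 then cl (o x.1) else o x.1); split => //=.
- move=> [s b] [t b'] /= eq.
  have ss (c : bool) r : (if c then cl (o r) else o r) \in [set o r; cl (o r)].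
    by case: c; rewrite !inE eqxx ?orbT.
  have := ss b s; rewrite {1}eq => /(o_blk t s _ (ss b' t)) st; subst s; congr (_, _).
  have /andP[ltt _] := o_arc t.
  by case: b b' eq {ss} => -[] // eq; have /= := congr1 val eq; lia.
- by move=> t; have /andP[] := o_arc t.
apply/setP => B; apply/idP/mem_arcs_of => [BM|[t ->]]; last by have /andP[] := o_arc t.
have [a [b [lt eqB]]] := pairM B BM.
have aO : a \in O by rewrite inE; apply/existsP; exists b; rewrite /arc lt -eqB.
have [t at_] := o_surj a aO; exists t => /=.
have /andP[_ tM] := o_arc t.
by rewrite -(blockE a B) ?(blockE a _ _ tM) // ?eqB at_ !inE eqxx.
Qed.

End Enumeration.

(** * Reversal *)

(** An increasing [f] is injective, so the image of [P] has as many arcs as [P]; with [#|P| = m]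
    this is the required number of chosen arcs. *)
Lemma containsP n m (M : {set {set 'I_n.*2}}) (P : {set {set 'I_m.*2}}) : #|P| = m ->
  reflect (exists2 f : 'I_m.*2 -> 'I_n.*2, (forall x y : 'I_m.*2, x < y -> f x < f y) &
             forall B, B \in P -> f @: B \in M) (contains M P).
Proof.
move=> cardP; apply: (iffP existsP) => [[A /and3P[/subsetP AM _ /existsP[f /andP[/'forall_forallP mf /eqP eqA]]]]|[f mf fM]].
  exists f => [x y|B BP]; first by move/(implyP (mf x y)).
  by apply: AM; rewrite eqA; apply/imsetP; exists B.
have f_inj : injective f.
  by move=> x y eq; case: (ltngtP x y) => [/mf|/mf|/ord_inj //]; rewrite eq ltnn.
exists [set f @: (B : {set 'I_m.*2}) | B in P]; apply/and3P; split.
- by apply/subsetP => _ /imsetP[B BP ->]; apply: fM.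
- by rewrite card_imset ?cardP //; apply: imset_inj.
apply/existsP; exists (finfun f); apply/andP; split.
  by apply/'forall_forallP => x y; apply/implyP => /mf; rewrite !ffunE.
by apply/eqP; apply: eq_imset => B; apply: eq_imset => x; rewrite ffunE.
Qed.

Section Reversal.

Definition rev_matching n (M : {set {set 'I_n.*2}}) : {set {set 'I_n.*2}} :=
  [set (@rev_ord n.*2) @: (B : {set 'I_n.*2}) | B in M].

Lemma rev_matchingK n : involutive (@rev_matching n).
Proof.
move=> M; rewrite /rev_matching -imset_comp -[RHS]imset_id.
apply: eq_imset => B /=; rewrite -imset_comp -[RHS]imset_id.
by apply: eq_imset => x /=; rewrite rev_ordK.
Qed.

Lemma mem_rev_matching n (M : {set {set 'I_n.*2}}) (B : {set 'I_n.*2}) :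
  ((@rev_ord _) @: B \in rev_matching M) = (B \in M).
Proof. by rewrite mem_imset //; apply: imset_inj; apply: rev_ord_inj. Qed.

Lemma arc_rev n (M : {set {set 'I_n.*2}}) a b :
  arc (rev_matching M) a b = arc M (rev_ord b) (rev_ord a).
Proof.
rewrite /arc -[X in X \in rev_matching M](_ : (@rev_ord _) @: [set rev_ord b; rev_ord a] = _).
  by rewrite mem_rev_matching; congr (_ && _); have := ltn_ord a; have := ltn_ord b; rewrite /=; lia.
by rewrite imsetU !imset_set1 !rev_ordK setUC.
Qed.

Lemma rev_is_matching n (M : {set {set 'I_n.*2}}) : is_matching M -> is_matching (rev_matching M).
Proof.
move=> /matching_enumerates[e [e_inj _ _ ->]].
have -> : rev_matching (arcs_of e) = arcs_of (fun x => rev_ord (e x)).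
  rewrite /rev_matching /arcs_of -imset_comp; apply: eq_imset => t /=.
  by rewrite imsetU !imset_set1.
by apply: is_matching_arcs_of => x y /rev_ord_inj/e_inj.
Qed.

(** Reversal exchanges openers and closers, so the two forbidden types are swapped. *)
Lemma has_type2_rev n (M : {set {set 'I_n.*2}}) : has_type2 (rev_matching M) -> has_type1 M.
Proof.
move=> /existsP[j /existsP[j' /existsP[k /existsP[l /and4P[/eqP jj kl a1 a2]]]]].
apply/existsP; exists (rev_ord j'); apply/existsP; exists (rev_ord j).
apply/existsP; exists (rev_ord l); apply/existsP; exists (rev_ord k).
rewrite -!arc_rev a1 a2 !andbT /= jj.
have := ltn_ord j'; have := ltn_ord l; lia.
Qed.

Lemma has_type1_rev n (M : {set {set 'I_n.*2}}) : has_type1 (rev_matching M) -> has_type2 M.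
Proof.
move=> /existsP[j /existsP[j' /existsP[k /existsP[l /and4P[/eqP jj kl a1 a2]]]]].
apply/existsP; exists (rev_ord j'); apply/existsP; exists (rev_ord j).
apply/existsP; exists (rev_ord l); apply/existsP; exists (rev_ord k).
rewrite -!arc_rev a1 a2 !andbT /= jj.
have := ltn_ord j'; have := ltn_ord l; lia.
Qed.

Lemma stoimenow_rev n (M : {set {set 'I_n.*2}}) : stoimenow M -> stoimenow (rev_matching M).
Proof.
move=> /and3P[matM t1 t2]; apply/and3P; split; first exact: rev_is_matching.
  by apply: contra t2; apply: has_type1_rev.
by apply: contra t1; apply: has_type2_rev.
Qed.

Lemma contains_rev n m (M : {set {set 'I_n.*2}}) (P : {set {set 'I_m.*2}}) : #|P| = m ->
  contains (rev_matching M) (rev_matching P) -> contains M P.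
Proof.
move=> cardP /containsP[|f mf fM].
  by rewrite card_imset //; apply: imset_inj; apply: rev_ord_inj.
apply/containsP => //; exists (fun x => rev_ord (f (rev_ord x))) => [x y xy|B BP].
  have /= := mf (rev_ord y) (rev_ord x); have := ltn_ord y => lt /(_ _)/wrap[]; first lia.
  by have := ltn_ord (f (rev_ord x)); lia.
rewrite -mem_rev_matching -imset_comp.
have := fM ((@rev_ord _) @: B); rewrite mem_rev_matching -imset_comp => /(_ BP).
by move=> h; rewrite (@eq_imset _ _ _ (f \o @rev_ord _)) // => x /=; rewrite rev_ordK.
Qed.

Lemma card_avoiders_rev n m (S : seq {set {set 'I_m.*2}}) : all (fun P : {set {set 'I_m.*2}} => #|P| == m) S ->
  #|stoimenow_avoiders n [seq rev_matching P | P <- S]| = #|stoimenow_avoiders n S|.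
Proof.
move=> cardS; rewrite -[RHS](card_imset _ (can_inj (@rev_matchingK n))).
apply: eq_card => M'; have [M ->] : exists M, M' = rev_matching M.
  by exists (rev_matching M'); rewrite rev_matchingK.
rewrite mem_imset; last exact: can_inj (@rev_matchingK n).
rewrite !inE.
have -> : stoimenow (rev_matching M) = stoimenow M.
  by apply/idP/idP => /stoimenow_rev //; rewrite rev_matchingK.
congr (_ && _); rewrite all_map; apply: eq_in_all => P PS /=.
have cardP := eqP (allP cardS P PS).
congr (~~ _); apply/idP/idP; first exact: contains_rev.
rewrite -{1}[M]rev_matchingK -{1}[P]rev_matchingK; apply: contains_rev.
by rewrite card_imset //; apply: imset_inj; apply: rev_ord_inj.
Qed.

End Reversal.

(** * Matchings and cells *)

(** The order in which points are placed, by their keys: run, other coordinate, arc number. Runs of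
    openers and of closers alternate, so the rank [i] run of openers gets the number [2i] and the
    rank [j] run of closers [2j + 1]. *)
Definition klt (a b : nat * nat * nat) : bool :=
  (a.1.1 < b.1.1) || (a.1.1 == b.1.1) &&
  ((a.1.2 < b.1.2) || (a.1.2 == b.1.2) && (a.2 < b.2)).

(* The cell [c t = (i, j)] of the arc number [t] tells that its opener is in the
   [i]-th run of openers and its closer in the [j]-th run of closers. A point
   is located by its run, then by the other coordinate: a Stoimenow matching has
   no nesting of arcs with both openers, or both closers, in the same run. *)
Definition key (c : nat -> nat * nat) (x : nat * bool) : nat * nat * nat :=
  if x.2 then ((c x.1).2.*2.+1, (c x.1).1, x.1) else ((c x.1).1.*2, (c x.1).2, x.1).

(* The rows and the columns which occur form the same initial segment of [nat]:
   the cells are the entries of an upper triangular matrix without zero row or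
   column. *)
Definition fishburn n (c : nat -> nat * nat) :=
  [/\ forall t, t < n -> (c t).1 <= (c t).2,
      forall t i, t < n -> i <= (c t).2 -> exists2 s, s < n & (c s).1 = i &
      forall t j, t < n -> j <= (c t).2 -> exists2 s, s < n & (c s).2 = j].

Definition lexsorted n (c : nat -> nat * nat) :=
  forall s t, s < t -> t < n ->
    (c s).1 < (c t).1 \/ (c s).1 = (c t).1 /\ (c s).2 <= (c t).2.

(** * From cells to Stoimenow matchings *)

Section Ranking.
Variable n : nat.
Let E := ('I_n * bool)%type.
Variable c : nat -> nat * nat.

Definition ekey (x : E) := key c (x.1 : nat, x.2).

Lemma ekey_inj x y : ~~ klt (ekey x) (ekey y) -> ~~ klt (ekey y) (ekey x) -> x = y.
Proof.
case: x y => [t b] [s b']; rewrite /klt /ekey /key /=.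
move=> h1 h2; have [ts bb] : t = s :> nat /\ b = b' by move: h1 h2; case: b; case: b' => /=; lia.
by rewrite bb; congr (_, _); apply: ord_inj.
Qed.

Definition rank_of (x : E) := #|[set y : E | klt (ekey y) (ekey x)]|.

Lemma rank_ltn (x : E) : rank_of x < n.*2.
Proof.
rewrite -endpoint_card -cardsT; apply: proper_card.
rewrite properE subsetT /=; apply/subsetPn; exists x; rewrite ?inE // /klt; lia.
Qed.

Definition pos (x : E) : 'I_n.*2 := Ordinal (rank_ltn x).

Lemma pos_ltW (x y : E) : klt (ekey x) (ekey y) -> pos x < pos y.
Proof.
move=> lt; apply: proper_card; rewrite properE; apply/andP; split.
  by apply/subsetP => z; rewrite !inE /klt in lt *; lia.
by apply/subsetPn; exists x; rewrite ?inE // /klt; lia.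
Qed.

Lemma pos_lt (x y : E) : (pos x < pos y) = klt (ekey x) (ekey y).
Proof.
apply/idP/idP; last exact: pos_ltW.
case: (boolP (klt (ekey x) (ekey y))) => // n1.
case: (boolP (klt (ekey y) (ekey x))) => [/pos_ltW|n2]; first lia.
by rewrite (ekey_inj n1 n2) ltnn.
Qed.

Lemma pos_inj : injective pos.
Proof.
move=> x y eq; apply: ekey_inj; rewrite -pos_lt eq ltnn //.
Qed.

(** Both maps send [x] to the number of endpoints that precede it. *)
Lemma pos_unique (e : E -> 'I_n.*2) : injective e ->
  (forall x y, e x < e y -> klt (ekey x) (ekey y)) -> e =1 pos.
Proof.
move=> e_inj mono x; apply: ord_inj; rewrite /= /rank_of.
rewrite -{1}(card_ltn_ord (e x)) -[RHS](card_imset _ e_inj); apply: eq_card => p.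
have [y <-] := endpoint_surj e_inj p; rewrite inE mem_imset // inE.
apply/idP/idP; first exact: mono.
case: (ltngtP (e y) (e x)) => [||/ord_inj/e_inj->]; rewrite // /klt; last lia.
by move/mono; rewrite /klt; lia.
Qed.

Definition cell_matching := arcs_of pos.

Hypothesis fishc : fishburn n c.

Lemma pos_arc (t : 'I_n) : pos (t, false) < pos (t, true).
Proof.
have [le _ _] := fishc; rewrite pos_lt /klt /ekey /key /=.
by have := le _ (ltn_ord t); lia.
Qed.

Lemma is_matching_cell_matching : is_matching cell_matching.
Proof. exact: is_matching_arcs_of pos_inj. Qed.

Lemma cell_matching_enumerates : lexsorted n c -> enumerates pos cell_matching.
Proof.
move=> sortc; split=> //; [exact: pos_inj|exact: pos_arc|].
move=> s t st; rewrite pos_lt /klt /ekey /key /=.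
have := sortc _ _ st (ltn_ord t); lia.
Qed.

Lemma no_between (x y z : E) : pos y = (pos x).+1 :> nat ->
  klt (ekey x) (ekey z) -> klt (ekey z) (ekey y) -> False.
Proof. rewrite -!pos_lt => ->; lia. Qed.

(** Openers in different rows are separated by a closer in the column numbered by the smaller row,
    so they are not adjacent. In the same row, the keys put the closers in the order of the
    openers. *)
Lemma cell_matching_no_type1 : ~~ has_type1 cell_matching.
Proof.
apply/negP => /existsP[i /existsP[i' /existsP[k /existsP[l /and4P[/eqP ii kl]]]]].
move=> /(arc_arcs_of _ _ pos_arc)[t ei el] /(arc_arcs_of _ _ pos_arc)[s ei' ek].
subst; have lt : pos (t, false) < pos (s, false) by rewrite ii.
rewrite pos_lt in kl; rewrite pos_lt in lt.
have [le _ cols] := fishc.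
case: (ltnP (c t).1 (c s).1) => [lt1|le1].
  have [r rn er] := cols t (c t).1 (ltn_ord t) (le _ (ltn_ord t)).
  by apply: (@no_between _ _ (Ordinal rn, true) ii);
    move: kl lt; rewrite /klt /ekey /key /=; lia.
by move: kl lt; rewrite /klt /ekey /key /=; lia.
Qed.

(** Dually, closers in different columns are separated by an opener in the row numbered by the
    larger column. *)
Lemma cell_matching_no_type2 : ~~ has_type2 cell_matching.
Proof.
apply/negP => /existsP[i /existsP[i' /existsP[k /existsP[l /and4P[/eqP ii kl]]]]].
move=> /(arc_arcs_of _ _ pos_arc)[t ei el] /(arc_arcs_of _ _ pos_arc)[s ei' ek].
subst; have lt : pos (s, true) < pos (t, true) by rewrite ii.
rewrite pos_lt in kl; rewrite pos_lt in lt.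
have [le rows _] := fishc.
case: (ltnP (c s).2 (c t).2) => [lt1|le1].
  have [r rn er] := rows t (c t).2 (ltn_ord t) (leqnn _).
  by apply: (@no_between _ _ (Ordinal rn, false) ii);
    move: kl lt; rewrite /klt /ekey /key /=; lia.
by move: kl lt; rewrite /klt /ekey /key /=; lia.
Qed.

Lemma stoimenow_cell_matching : stoimenow cell_matching.
Proof. by rewrite /stoimenow is_matching_cell_matching cell_matching_no_type1 cell_matching_no_type2. Qed.

End Ranking.

(** * Runs, and the cells of a given Stoimenow matching *)

Definition level (ty : nat -> bool) p := \sum_(q < p) (ty q (+) ty q.+1 : nat).

Lemma levelS ty p : level ty p.+1 = level ty p + (ty p (+) ty p.+1).
Proof. by rewrite /level big_ord_recr. Qed.

Lemma level_mono ty p q : p <= q -> level ty p <= level ty q.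
Proof.
elim: q => [|q IHq]; first by rewrite leqn0 => /eqP->.
rewrite leq_eqVlt => /predU1P[->//|pq].
by rewrite levelS (leq_trans (IHq pq)) // leq_addr.
Qed.

Lemma odd_level ty p : odd (level ty p) = ty 0 (+) ty p.
Proof.
elim: p => [|p IHp]; first by rewrite /level big_ord0 addbb.
by rewrite levelS oddD IHp oddb addbA addbK.
Qed.

Lemma level_ivt ty p v : v <= level ty p -> exists2 q, q <= p & level ty q = v.
Proof.
elim: p => [|p IHp]; first by rewrite /level big_ord0 leqn0 => /eqP->; exists 0; rewrite ?big_ord0.
case: (leqP v (level ty p)) => [/IHp[q qp eq] _|lt le]; first by exists q; rewrite ?(leqW qp).
by exists p.+1 => //; move: lt le; rewrite levelS; case: (_ (+) _); lia.
Qed.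

Section Runs.
Variables (n : nat) (M : {set {set 'I_n.*2}}) (e : 'I_n * bool -> 'I_n.*2).
Hypothesis enumM : enumerates e M.

Definition closer_at q := [exists t, e (t, true) == q :> nat].
Let L := level closer_at.

Lemma closer_at_e t b : closer_at (e (t, b)) = b.
Proof.
have [e_inj _ _ _] := enumM; apply/existsP/idP => [[s /eqP/ord_inj/e_inj[]]|->] //.
by exists t.
Qed.

Lemma closer_at0 : closer_at 0 = false.
Proof.
have [_ lt_e _ _] := enumM.
by apply/negbTE/existsPn => t; rewrite -lt0n (leq_ltn_trans _ (lt_e t)).
Qed.

Lemma odd_level_e t b : odd (L (e (t, b))) = b.
Proof. by rewrite odd_level closer_at0 closer_at_e. Qed.

Lemma same_level_closer p q r : L p = L q -> p <= r <= q -> closer_at r = closer_at p.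
Proof.
move=> eq /andP[/(level_mono closer_at) pr /(level_mono closer_at) rq].
have : odd (L r) = odd (L p) by congr odd; rewrite /L in eq pr rq *; lia.
by rewrite !odd_level closer_at0.
Qed.

Lemma enum_at q : q < n.*2 -> exists x, e x = q :> nat.
Proof.
move=> qn; have [e_inj _ _ _] := enumM.
by have [x ex] := endpoint_surj e_inj (Ordinal qn); exists x; rewrite ex.
Qed.

Lemma level_attained t b v : v <= L (e (t, b)) ->
  exists s, L (e (s, odd v)) = v.
Proof.
case/level_ivt => q qle eqv; have [[s b'] es] := enum_at (leq_ltn_trans qle (ltn_ord _)).
by exists s; rewrite -{1}eqv -es odd_level_e es.
Qed.

(** [L] numbers the runs from 0. The first point is an opener, so runs of openers have even numbers
    and runs of closers odd ones; halving gives the rank among the runs of the same kind. The pair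
    (0, 0) is a default value for [t >= n]. *)
Definition cells_of t : nat * nat :=
  oapp (fun t' => ((L (e (t', false)))./2, (L (e (t', true)))./2)) (0, 0) (insub t).

Lemma cells_ofE (t : 'I_n) :
  ((cells_of t).1.*2 = L (e (t, false))) * ((cells_of t).2.*2.+1 = L (e (t, true))).
Proof.
rewrite /cells_of valK /=.
by split; rewrite -[RHS]odd_double_half odd_level_e.
Qed.

(** The level starts at 0 and grows by steps of at most 1, so each number up to the level of a
    closer is attained: the even ones at openers, the odd ones at closers. *)
Lemma cells_of_fishburn : fishburn n cells_of.
Proof.
have [_ lt_e _ _] := enumM.
split=> [t tn|t i tn|t j tn].
- have [e1 e2] := cells_ofE (Ordinal tn); have := level_mono closer_at (ltnW (lt_e (Ordinal tn))).
  by rewrite /L /= in e1 e2 *; lia.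
- have [e1 e2] := cells_ofE (Ordinal tn) => le.
  have [|s] := @level_attained (Ordinal tn) true i.*2; first by rewrite -e2 /=; lia.
  by rewrite odd_double => es; exists s => //; have [] := cells_ofE s; lia.
have [e1 e2] := cells_ofE (Ordinal tn) => le.
have [|s] := @level_attained (Ordinal tn) true j.*2.+1; first by rewrite -e2 /=; lia.
rewrite oddS odd_double => es; exists s => //; have [_ es2] := cells_ofE s.
by apply: double_inj; apply: succn_inj; rewrite es2 -es.
Qed.

Hypothesis stoiM : stoimenow M.

(** For adjacent openers this is the absence of Type 1; induction on the distance [m.+1] extends it
    along the run. *)
Lemma opener_run m s t : e (t, false) = e (s, false) + m.+1 :> nat ->
  L (e (s, false)) = L (e (t, false)) -> e (s, true) < e (t, true).
Proof.
have [e_inj lt_e _ eqM] := enumM.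
have [_ /existsPn noT1 _] := and3P stoiM.
elim: m s => [|m IHm] s est eqL.
  case: (ltngtP (e (s, true)) (e (t, true))) => // [lt|/ord_inj/e_inj[st]]; last by rewrite st in est; lia.
  have := noT1 (e (s, false)).
  move=> /existsPn/(_ (e (t, false)))/existsPn/(_ (e (t, true)))/existsPn/(_ (e (s, true))).
  rewrite est addn1 eqxx lt /= negb_and eqM.
  by case/orP => /negP[]; apply/arc_arcs_of => //; [exists s|exists t].
(* The next point lies in the same run, so it is the opener of some arc [r]. *)
have [[r b] er] := @enum_at (e (s, false)).+1 ltac:(have := ltn_ord (e (t, false)); lia).
have b0 : b = false.
  rewrite -(closer_at_e r b) -(closer_at_e s false) er.
  by apply: same_level_closer eqL _; rewrite est; lia.
subst b.
have Lr : L (e (r, false)) = L (e (t, false)).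
  apply/eqP; rewrite eqn_leq level_mono; last lia.
  by rewrite -eqL level_mono //; lia.
apply: ltn_trans (IHm r _ Lr); last by rewrite er est; lia.
have := noT1 (e (s, false)).
move=> /existsPn/(_ (e (r, false)))/existsPn/(_ (e (r, true)))/existsPn/(_ (e (s, true))).
rewrite er eqxx /= eqM; case: (ltngtP (e (s, true)) (e (r, true))) => // [lt|/ord_inj/e_inj[sr]].
  by rewrite /= negb_and; case/orP => /negP[]; apply/arc_arcs_of => //; [exists s|exists r].
by rewrite sr in er; lia.
Qed.

(** The dual statement, from the absence of Type 2. *)
Lemma closer_run m s t : e (t, true) = e (s, true) + m.+1 :> nat ->
  L (e (s, true)) = L (e (t, true)) -> e (s, false) < e (t, false).
Proof.
have [e_inj lt_e _ eqM] := enumM.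
have [_ _ /existsPn noT2] := and3P stoiM.
have step r q : e (q, true) = (e (r, true)).+1 :> nat -> e (r, false) < e (q, false).
  move=> erq; case: (ltngtP (e (r, false)) (e (q, false))) => // [lt|/ord_inj/e_inj[rq]]; last first.
    by rewrite rq in erq; lia.
  have := noT2 (e (r, true)).
  move=> /existsPn/(_ (e (q, true)))/existsPn/(_ (e (q, false)))/existsPn/(_ (e (r, false))).
  rewrite erq eqxx lt /= negb_and eqM.
  by case/orP => /negP[]; apply/arc_arcs_of => //; [exists q|exists r].
elim: m s => [|m IHm] s est eqL; first by apply: step; rewrite est addn1.
have [[r b] er] := @enum_at (e (s, true)).+1 ltac:(have := ltn_ord (e (t, true)); lia).
have b1 : b = true.
  rewrite -(closer_at_e r b) -(closer_at_e s true) er.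
  by apply: same_level_closer eqL _; rewrite est; lia.
subst b.
have Lr : L (e (r, true)) = L (e (t, true)).
  apply/eqP; rewrite eqn_leq level_mono; last lia.
  by rewrite -eqL level_mono //; lia.
by apply: ltn_trans (step _ _ er) (IHm r _ Lr); rewrite er est; lia.
Qed.

(** It suffices that keys increase along the points. Different runs are ordered by level. Within a
    run, [opener_run] and [closer_run] order the opposite endpoints, hence weakly the second entries
    of the keys, and the arc numbers break ties. *)
Lemma eq_pos_cells_of : e =1 pos cells_of.
Proof.
have [e_inj lt_e mono eqM] := enumM.
apply: pos_unique => // -[s b] [t b'] lt.
have [es1 es2] := cells_ofE s; have [et1 et2] := cells_ofE t.
have le := level_mono closer_at (ltnW lt); rewrite -/L in le.
have o1 := odd_level_e s b; have o2 := odd_level_e t b'.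
case: b b' lt le o1 o2 => -[] lt le o1 o2.
- have [eqL|neq] := eqVneq (L (e (s, true))) (L (e (t, true))); last first.
    by rewrite /klt /ekey /key /=; lia.
  have lto := @closer_run (e (t, true) - e (s, true)).-1 s t ltac:(lia) eqL.
  have lel := level_mono closer_at (ltnW lto); rewrite -/L in lel.
  have st : s < t by case: (ltngtP s t) lto => [//|/mono|/ord_inj->]; lia.
  by rewrite /klt /ekey /key /=; lia.
- have neq : L (e (s, true)) <> L (e (t, false)) by move=> eq; rewrite eq o2 in o1.
  by rewrite /klt /ekey /key /=; lia.
- have neq : L (e (s, false)) <> L (e (t, true)) by move=> eq; rewrite eq o2 in o1.
  by rewrite /klt /ekey /key /=; lia.
have st : s < t by case: (ltngtP s t) lt => [//|/mono|/ord_inj->]; lia.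
have [eqL|neq] := eqVneq (L (e (s, false))) (L (e (t, false))); last first.
  by rewrite /klt /ekey /key /=; lia.
have ltc := @opener_run (e (t, false) - e (s, false)).-1 s t ltac:(lia) eqL.
have lel := level_mono closer_at (ltnW ltc); rewrite -/L in lel.
by rewrite /klt /ekey /key /=; lia.
Qed.

Lemma cells_of_lexsorted : lexsorted n cells_of.
Proof.
have [_ _ mono _] := enumM => s t st tn; have sn := ltn_trans st tn.
have := mono (Ordinal sn) (Ordinal tn) st.
by rewrite !eq_pos_cells_of pos_lt /klt /ekey /key /=; lia.
Qed.

Lemma cell_matching_cells_of : M = cell_matching n cells_of.
Proof.
have [_ _ _ ->] := enumM; rewrite /cell_matching /arcs_of.
by apply: eq_imset => t; rewrite !eq_pos_cells_of.
Qed.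

End Runs.

Lemma stoimenow_cells n (M : {set {set 'I_n.*2}}) : stoimenow M ->
  exists c, [/\ fishburn n c, lexsorted n c & M = cell_matching n c].
Proof.
move=> stoiM; have /and3P[/matching_enumerates[e enumM] _ _] := stoiM.
exists (cells_of e); split; first exact: cells_of_fishburn enumM.
  exact: cells_of_lexsorted enumM stoiM.
exact: cell_matching_cells_of enumM stoiM.
Qed.

(** Induction on the position. All run numbers up to a given one occur, so from a point to the next
    the number rises by at most 1, and the parity tells whether it does. *)
Lemma key_level n c (x : 'I_n * bool) : fishburn n c -> lexsorted n c ->
  (ekey c x).1.1 = level (closer_at (@pos n c)) (pos c x).
Proof.
move=> fishc sortc; have enumc := cell_matching_enumerates fishc sortc.
have [le rows cols] := fishc.
have par (y : 'I_n * bool) : odd (ekey c y).1.1 = closer_at (@pos n c) (pos c y).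
  by case: y => t b; rewrite (closer_at_e enumc) /ekey /key; case: b; rewrite /= odd_double.
have attained (y : 'I_n * bool) v : v <= (ekey c y).1.1 -> exists z : 'I_n * bool, (ekey c z).1.1 = v.
  case: y => t b vle; have {}vle : v./2 <= (c t).2.
    have := le t (ltn_ord t).
    by move: vle; rewrite /ekey /key; case: b => /=; lia.
  have := odd_double_half v; case: (odd v) => <-.
    have [s sn es] := cols t _ (ltn_ord t) vle.
    by exists (Ordinal sn, true); rewrite /ekey /key /= es.
  have [s sn es] := rows t _ (ltn_ord t) vle.
  by exists (Ordinal sn, false); rewrite /ekey /key /= es.
move: {2}(nat_of_ord (pos c x)) (erefl (nat_of_ord (pos c x))) => p.
elim: p x => [|p IHp] x ex.
  have [z ez] := attained x 0 (leq0n _).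
  rewrite ex /level big_ord0; have := ltn0 (pos c z); rewrite -ex pos_lt /klt ez; lia.
have [y ey] := enum_at enumc (ltn_trans (ltac:(lia) : p < pos c x) (ltn_ord _)).
have yx : pos c y < pos c x by lia.
have step : (ekey c x).1.1 <= (ekey c y).1.1.+1.
  rewrite leqNgt; apply/negP => gt.
  have [z ez] := attained x _ (ltnW gt).
  by apply: (@no_between _ c y x z); rewrite ?ex ?ey // /klt ez; lia.
have odd_x := par x; have odd_y := par y.
rewrite ex levelS -ex -ey -(IHp y ey) ex -ey -odd_y.
move: odd_x; rewrite ex -ey => <-; move: yx; rewrite pos_lt /klt.
case: (ltngtP (ekey c y).1.1 (ekey c x).1.1) => [lt _||->] //; last by rewrite addbb addn0.
have -> : (ekey c x).1.1 = (ekey c y).1.1.+1 by lia.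
by rewrite /= addbN addbb addn1.
Qed.

(** The matching determines its enumeration, hence positions and levels, and the cells by
    [key_level]. *)
Lemma cell_matching_inj n c c' : fishburn n c -> lexsorted n c -> fishburn n c' -> lexsorted n c' ->
  cell_matching n c = cell_matching n c' -> forall t, t < n -> c t = c' t.
Proof.
move=> fc sc fc' sc' eqM t tn.
have enumc := cell_matching_enumerates fc sc; have enumc' := cell_matching_enumerates fc' sc'.
have eqpos : @pos n c =1 @pos n c' by apply: (enumerates_unique enumc); rewrite eqM.
have eqlev q : level (closer_at (@pos n c)) q = level (closer_at (@pos n c')) q.
  by apply: eq_bigr => i _; rewrite /closer_at; congr (nat_of_bool (_ (+) _));
     apply: eq_existsb => s; rewrite eqpos.
have lo := key_level (Ordinal tn, false) fc sc; have lc := key_level (Ordinal tn, true) fc sc.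
have := key_level (Ordinal tn, false) fc' sc'; have := key_level (Ordinal tn, true) fc' sc'.
rewrite -!eqpos -!eqlev -lo -lc /ekey /key /=.
case: (c t) (c' t) => [i j] [i' j'] /= e1 e2; congr (_, _); lia.
Qed.

(** * Patterns as conditions on cells *)

(* A pattern is also given by the word of its endpoints: [(i, false)] and
   [(i, true)] stand for the opener and the closer of the arc number [i]. *)
Definition word_arcs m (w : seq (nat * bool)) :=
  [seq ((index (i, false) w).+1, (index (i, true) w).+1) | i <- iota 0 m].

Definition word1 := [:: (0, false); (1, false); (0, true); (2, false); (2, true); (3, false); (1, true); (3, true)].
Definition word2 := [:: (0, false); (1, false); (0, true); (2, false); (1, true); (3, false); (2, true); (3, true)].
Definition word3 := [:: (0, false); (0, true); (1, false); (2, false); (1, true); (2, true); (3, false); (3, true)].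
Definition word4 := [:: (0, false); (0, true); (1, false); (2, false); (1, true); (3, false); (2, true); (3, true)].
Definition word5 := [:: (0, false); (1, false); (0, true); (2, false); (1, true); (2, true); (3, false); (3, true)].

Definition wf_word m (w : seq (nat * bool)) :=
  [&& uniq w, size w == m.*2, all (fun x => x.1 < m) w &
      all (fun i => index (i, false) w < index (i, true) w < size w) (iota 0 m)].

Section Words.
Variables (m : nat) (w : seq (nat * bool)).
Hypothesis wfw : wf_word m w.

Let sizew : size w = m.*2. Proof. by have /and4P[_ /eqP] := wfw. Qed.
Let uniqw : uniq w. Proof. by have /and4P[] := wfw. Qed.
Let idx_lt i : i < m -> index (i, false) w < index (i, true) w < m.*2.
Proof.
by move=> im; have /and4P[_ /eqP<- _ /allP] := wfw; apply; rewrite mem_iota.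
Qed.
Let nth_lt q : q < m.*2 -> (nth (0, false) w q).1 < m.
Proof.
by move=> qm; have /and4P[_ /eqP sz /allP allw _] := wfw; apply: allw; rewrite mem_nth // sz.
Qed.
Let idx_bound i (b : bool) : i < m -> index (i, b) w < m.*2.
Proof. by move=> /idx_lt /andP[lt1 lt2]; case: b => //; apply: ltn_trans lt2. Qed.

Let pt i (b : bool) (im : i < m) : 'I_m.*2 := Ordinal (idx_bound b im).

Let block i (im : i < m) : {set 'I_m.*2} := [set pt false im; pt true im].

Lemma mem_word_pattern (B : {set 'I_m.*2}) :
  reflect (exists i, exists im : i < m, B = block im) (B \in pattern m (word_arcs m w)).
Proof.
have blockE i (im : i < m) : block im =
    [set x : 'I_m.*2 | (x.+1 == (index (i, false) w).+1) || (x.+1 == (index (i, true) w).+1)].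
  by apply/setP => x; rewrite !inE.
rewrite inE /word_arcs -map_comp; apply: (iffP mapP) => [[i]|[i [im ->]]].
  by rewrite mem_iota => /= im ->; exists i, im; rewrite blockE.
by exists i; rewrite ?mem_iota // blockE.
Qed.

Lemma card_word_pattern : #|pattern m (word_arcs m w)| = m.
Proof.
pose B (i : 'I_m) := block (ltn_ord i).
have B_inj : injective B.
  move=> i j /setP /(_ (pt false (ltn_ord i))); rewrite !inE eqxx /=.
  have nthi (k : 'I_m) b : nth (0, false) w (index (nat_of_ord k, b) w) = (nat_of_ord k, b).
    by rewrite nth_index // -index_mem sizew idx_bound.
  by move=> /esym/orP[] /eqP /(congr1 (fun x : 'I_m.*2 => nth (0, false) w x)) /=;
    rewrite !nthi => -[] // /ord_inj.
rewrite -[RHS]card_ord -(card_imset _ B_inj); apply: eq_card => D.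
apply/mem_word_pattern/imsetP => [[i [im ->]]|[i _ ->]]; last by exists i, (ltn_ord i).
by exists (Ordinal im) => //; congr [set _; _]; apply: ord_inj.
Qed.

Lemma klt_trans : transitive klt.
Proof. by move=> y x z; rewrite /klt; lia. Qed.

(** A choice [t] of arcs is an occurrence exactly when the keys increase along the word of the
    pattern. Strictness forces the chosen arcs to be distinct. *)
Lemma contains_word n c : fishburn n c ->
  (contains (cell_matching n c) (pattern m (word_arcs m w)) <->
   exists2 t : nat -> nat, forall i, i < m -> t i < n &
     sorted klt [seq key c (t x.1, x.2) | x <- w]).
Proof.
move=> fishc; split.
  case/(containsP _ card_word_pattern) => f mf fM.
  have arcP (i : 'I_m) : exists s : 'I_n,
      f (pt false (ltn_ord i)) = pos c (s, false) /\ f (pt true (ltn_ord i)) = pos c (s, true).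
    have /fM : block (ltn_ord i) \in pattern m (word_arcs m w).
      by apply/mem_word_pattern; exists i, (ltn_ord i).
    rewrite imsetU !imset_set1 => inM.
    have : arc (cell_matching n c) (f (pt false (ltn_ord i))) (f (pt true (ltn_ord i))).
      by rewrite /arc inM andbT mf //=; have /andP[] := idx_lt (ltn_ord i).
    by case/(arc_arcs_of _ _ (pos_arc fishc)) => s; exists s.
  have [s Hs] := fin_all_exists arcP.
  pose t i := oapp (fun i' : 'I_m => s i' : nat) 0 (insub i).
  have tE (i : 'I_m) : t i = s i by rewrite /t valK.
  exists t => [i im|]; first by rewrite (tE (Ordinal im)) ltn_ord.
  have fE q (qm : q < m.*2) : exists2 x, f (Ordinal qm) = pos c x &
      ekey c x = key c (t (nth (0, false) w q).1, (nth (0, false) w q).2).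
    have im := nth_lt qm; exists (s (Ordinal im), (nth (0, false) w q).2).
      have idxq : index (nth (0, false) w q) w = q by rewrite index_uniq // sizew.
      have [so sc] := Hs (Ordinal im).
      case: (nth (0, false) w q) idxq im so sc => i [] /= idxq im so sc; [rewrite -sc|rewrite -so];
        by congr f; apply: ord_inj; rewrite /= idxq.
    by rewrite /ekey /= -(tE (Ordinal im)).
  apply/(sortedP (0, 0, 0)) => q; rewrite size_map sizew => qm.
  have qm' := ltnW qm; rewrite !(nth_map (0, false)) ?sizew //.
  have [x fx <-] := fE _ qm'; have [y fy <-] := fE _ qm.
  by rewrite -pos_lt -fx -fy; apply: mf.
case=> t tn sortt.
pose x (q : 'I_m.*2) := (Ordinal (tn _ (nth_lt (ltn_ord q))), (nth (0, false) w q).2).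
apply/(containsP _ card_word_pattern); exists (fun q => pos c (x q)) => [q r qr|B].
  have keyE (q' : 'I_m.*2) : ekey c (x q') =
      nth (0, 0, 0) [seq key c (t x.1, x.2) | x <- w] q'.
    by rewrite (nth_map (0, false)) // sizew.
  rewrite pos_lt !keyE; apply: (sorted_ltn_nth klt_trans) => //; rewrite inE size_map sizew;
    exact: ltn_ord.
case/mem_word_pattern => i [im ->]; rewrite imsetU !imset_set1.
have xE b : x (pt b im) = (Ordinal (tn _ im), b).
  rewrite /x; have nthE : nth (0, false) w (pt b im) = (i, b).
    by rewrite nth_index // -index_mem sizew idx_bound.
  by congr (_, _); [apply: ord_inj|]; rewrite /= nthE.
by rewrite !xE; apply/mem_arcs_of; exists (Ordinal (tn _ im)).
Qed.

End Words.

Lemma P1E : P1 = pattern 4 (word_arcs 4 word1). Proof. by []. Qed.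
Lemma P2E : P2 = pattern 4 (word_arcs 4 word2). Proof. by []. Qed.
Lemma P3E : P3 = pattern 4 (word_arcs 4 word3). Proof. by []. Qed.
Lemma P4E : P4 = pattern 4 (word_arcs 4 word4). Proof. by []. Qed.
Lemma P5E : P5 = pattern 4 (word_arcs 4 word5). Proof. by []. Qed.

Section CellConditions.
Variables (n : nat) (c : nat -> nat * nat).
Hypothesis fishc : fishburn n c.

(** In [cell_P1], [cell_P2] and [cell_P4], [b] and [d] are the arcs 1 and 2 of the word. The arcs 0
    and 3 only record that a run ends before some endpoint, and nonempty rows and columns supply
    them. *)
Definition cell_P1 := exists b d, [/\ b < n, d < n, (c b).1 < (c d).1 & (c d).2 < (c b).2].
Definition cell_P2 := exists b d,
  [/\ b < n, d < n, (c b).1 < (c d).1, (c d).1 <= (c b).2 & (c b).2 < (c d).2].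
Definition cell_P3 := exists a b d e,
  [/\ [/\ a < n, b < n, d < n & e < n], b <> d, (c a).2 < (c b).1, (c d).2 < (c e).1 &
      [/\ (c b).1 <= (c d).1, (c d).1 <= (c b).2 & (c b).2 <= (c d).2]].
Definition cell_P4 := exists b d,
  [/\ b < n, d < n, 0 < (c b).1, (c b).1 <= (c d).1 & (c d).1 <= (c b).2 < (c d).2].
Definition cell_P5 := exists b d e,
  [/\ b < n, d < n, e < n, (c b).1 < (c d).1 & (c d).1 <= (c b).2 <= (c d).2 /\ (c d).2 < (c e).1].


Definition arcs4 (a b d e : nat) i := nth 0 [:: a; b; d; e] i.

Lemma arcs4_lt a b d e : a < n -> b < n -> d < n -> e < n ->
  forall i, i < 4 -> arcs4 a b d e i < n.
Proof. by move=> an bn dn en [|[|[|[|i]]]]. Qed.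


Lemma contains_P1 : contains (cell_matching n c) P1 <-> cell_P1.
Proof.
rewrite P1E (contains_word _ fishc) //; have [le rows cols] := fishc; split.
  case=> t tn /=; rewrite /klt /key /= => sortt.
  exists (t 1), (t 2); rewrite !tn //; split=> //; lia.
case=> b [d [bn dn lt1 lt2]].
have le_d := le d dn; have le_b := le b bn.
(* [a] closes in the run just after that of the opener of [b], and [f] opens in the run just before
   that of the closer of [b]. *)
have [a an ea] := cols b (c b).1 bn le_b.
have [f fn ef] := rows b (c b).2 bn (leqnn _).
have le_a := le a an; have le_f := le f fn.
exists (arcs4 a b d f); first exact: arcs4_lt.
by rewrite /arcs4 /klt /key /=; lia.
Qed.

Lemma contains_P2 : contains (cell_matching n c) P2 <-> cell_P2.
Proof.
rewrite P2E (contains_word _ fishc) //; have [le rows cols] := fishc; split.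
  case=> t tn /=; rewrite /klt /key /= => sortt.
  exists (t 1), (t 2); rewrite !tn //; split=> //; lia.
case=> b [d [bn dn lt1 lt2 lt3]].
have le_d := le d dn; have le_b := le b bn.
have [a an ea] := cols b (c b).1 bn le_b.
have [f fn ef] := rows d (c d).2 dn (leqnn _).
have le_a := le a an; have le_f := le f fn.
exists (arcs4 a b d f); first exact: arcs4_lt.
by rewrite /arcs4 /klt /key /=; lia.
Qed.

Lemma contains_P3 : contains (cell_matching n c) P3 <-> cell_P3.
Proof.
rewrite P3E (contains_word _ fishc) //; have [le rows cols] := fishc; split.
  case=> t tn /=; rewrite /klt /key /= => sortt.
  exists (t 0), (t 1), (t 2), (t 3); rewrite !tn //.
  by split=> //; [move=> eq; rewrite eq in sortt| | |split]; lia.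
(* Two arcs in the same cell cross, the one with the smaller number opening first. Hence the last
   condition of [main], and the exchange of [b] and [d] when it fails. *)
have main a b d f : [/\ a < n, b < n, d < n & f < n] -> (c a).2 < (c b).1 -> (c d).2 < (c f).1 ->
    (c b).1 <= (c d).1 -> (c d).1 <= (c b).2 -> (c b).2 <= (c d).2 ->
    [|| (c b).1 < (c d).1, (c b).2 < (c d).2 | b < d] ->
    exists2 t, forall i, i < 4 -> t i < n &
      sorted klt [seq key c (t x.1, x.2) | x <- word3].
  move=> [an bn dn fn] *; have le_d := le d dn; have le_b := le b bn.
  have le_a := le a an; have le_f := le f fn.
  exists (arcs4 a b d f); first exact: arcs4_lt.
  by rewrite /arcs4 /klt /key /=; lia.
case=> a [b [d [f [[an bn dn fn] neq lt1 lt2 [le1 le2 le3]]]]].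
case: (boolP [|| (c b).1 < (c d).1, (c b).2 < (c d).2 | b < d]) => [|n1]; first by apply: (main a b d f).
by apply: (main a d b f); rewrite ?an ?bn ?dn ?fn //; lia.
Qed.

Lemma contains_P4 : contains (cell_matching n c) P4 <-> cell_P4.
Proof.
rewrite P4E (contains_word _ fishc) //; have [le rows cols] := fishc; split.
  case=> t tn /=; rewrite /klt /key /= => sortt.
  exists (t 1), (t 2); rewrite !tn //; split=> //; lia.
case=> b [d [bn dn lt1 lt2 lt3]].
have le_d := le d dn; have le_b := le b bn.
have [a an ea] := cols b 0 bn (leq0n _).
have [f fn ef] := rows d (c d).2 dn (leqnn _).
have le_a := le a an; have le_f := le f fn.
exists (arcs4 a b d f); first exact: arcs4_lt.
by rewrite /arcs4 /klt /key /=; lia.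
Qed.

Lemma contains_P5 : contains (cell_matching n c) P5 <-> cell_P5.
Proof.
rewrite P5E (contains_word _ fishc) //; have [le rows cols] := fishc; split.
  case=> t tn /=; rewrite /klt /key /= => sortt.
  exists (t 1), (t 2), (t 3); rewrite !tn //; split=> //; lia.
case=> b [d [f [bn dn fn lt1 [lt2 lt3]]]].
have le_d := le d dn; have le_b := le b bn.
have [a an ea] := cols b (c b).1 bn le_b.
have le_a := le a an; have le_f := le f fn.
exists (arcs4 a b d f); first exact: arcs4_lt.
by rewrite /arcs4 /klt /key /=; lia.
Qed.

End CellConditions.

(** * Counting lists of cells *)

Definition cnt (d : nat -> bool) p := \sum_(q < p) (d q : nat).

Lemma cntS d p : cnt d p.+1 = cnt d p + d p.
Proof. by rewrite /cnt big_ord_recr. Qed.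

Lemma cnt0 d : cnt d 0 = 0.
Proof. by rewrite /cnt big_ord0. Qed.

Lemma cnt_mono d p q : p <= q -> cnt d p <= cnt d q.
Proof.
elim: q => [|q IHq]; first by rewrite leqn0 => /eqP->.
rewrite leq_eqVlt => /predU1P[->//|pq].
by rewrite cntS (leq_trans (IHq pq)) // leq_addr.
Qed.

Lemma cnt_hit d p b : b < cnt d p -> exists2 t, t < p & d t /\ cnt d t = b.
Proof.
elim: p => [|p IHp]; first by rewrite cnt0.
case: (ltnP b (cnt d p)) => [/IHp[t tp dt] _|le]; first by exists t; rewrite // ltnW.
by rewrite cntS => lt; exists p => //; case: (d p) lt; split=> //; lia.
Qed.

Lemma cell_matching_ext n c c' : (forall t, t < n -> c t = c' t) -> cell_matching n c = cell_matching n c'.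
Proof.
move=> eqc; have eqk (x : 'I_n * bool) : ekey c x = ekey c' x.
  by rewrite /ekey /key /= eqc.
have eqp (x : 'I_n * bool) : pos c x = pos c' x.
  by apply: ord_inj; apply: eq_card => y; rewrite !inE !eqk.
by apply: eq_imset => t; rewrite !eqp.
Qed.

Lemma card_non_singletons n : #|[set D : {set 'I_n} | #|D| != 1]| = 2 ^ n - n.
Proof.
have := cardsC [set D : {set 'I_n} | #|D| == 1].
rewrite card_draws card_ord bin1 -[#|{: {set 'I_n}}|]cardsT -powersetT card_powerset cardsT card_ord.
rewrite (_ : ~: _ = [set D : {set 'I_n} | #|D| != 1]); first lia.
by apply/setP => D; rewrite !inE.
Qed.

(** Avoiders correspond to their sorted lists of cells by [stoimenow_cells] and [cell_matching_inj],
    and [code] matches these lists with the non-singletons, given by their indicator functions. *)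
Lemma card_avoiders_coded n m (S : seq {set {set 'I_m.*2}}) (Q : (nat -> nat * nat) -> Prop)
    (code : (nat -> bool) -> nat -> nat * nat) :
  (forall c, fishburn n c -> (all (avoids (cell_matching n c)) S <-> Q c)) ->
  (forall d, cnt d n <> 1 -> [/\ fishburn n (code d), lexsorted n (code d) & Q (code d)]) ->
  (forall d d', (forall t, t < n -> d t = d' t) -> forall t, t < n -> code d t = code d' t) ->
  (forall d d', cnt d n <> 1 -> cnt d' n <> 1 ->
     (forall t, t < n -> code d t = code d' t) -> forall t, t < n -> d t = d' t) ->
  (forall c, fishburn n c -> lexsorted n c -> Q c ->
     exists2 d, cnt d n <> 1 & forall t, t < n -> c t = code d t) ->
  #|stoimenow_avoiders n S| = 2 ^ n - n.
Proof.
move=> QE codeP code_ext code_inj code_surj; rewrite -card_non_singletons.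
pose ind (D : {set 'I_n}) t := [exists x : 'I_n, (x \in D) && (x == t :> nat)].
have indE D (x : 'I_n) : ind D x = (x \in D).
  apply/existsP/idP => [[y /andP[yD /eqP/ord_inj <-]]|xD] //.
  by exists x; rewrite xD /=.
have cnt_ind D : cnt (ind D) n = #|D|.
  rewrite /cnt -sum1_card [RHS]big_mkcond; apply: eq_bigr => x _.
  by rewrite indE; case: (x \in D).
rewrite -(card_in_imset (f := fun D => cell_matching n (code (ind D)))); last first.
  move=> D D'; rewrite !inE => /eqP neq /eqP neq' eqM; rewrite -cnt_ind in neq; rewrite -cnt_ind in neq'.
  have [f1 s1 _] := codeP _ neq; have [f2 s2 _] := codeP _ neq'.
  have eqi := code_inj _ _ neq neq' (cell_matching_inj f1 s1 f2 s2 eqM).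
  by apply/setP => x; rewrite -!indE eqi.
apply: eq_card => M; rewrite inE; apply/andP/imsetP => [[stoiM avM]|[D]].
  have [c [fc sc eqM]] := stoimenow_cells stoiM; rewrite eqM in avM.
  have [d neq eqc] := code_surj c fc sc (iffLR (QE c fc) avM).
  have eqd t : t < n -> ind [set x : 'I_n | d x] t = d t.
    by move=> tn; rewrite (indE _ (Ordinal tn)) inE.
  have eqcnt : cnt (ind [set x : 'I_n | d x]) n = cnt d n.
    by apply: eq_bigr => x _; rewrite eqd.
  have neq' : cnt (ind [set x : 'I_n | d x]) n <> 1 by rewrite eqcnt.
  exists [set x : 'I_n | d x]; first by rewrite inE -cnt_ind; apply/eqP.
  by rewrite eqM; apply: cell_matching_ext => t tn; rewrite eqc //; apply: code_ext => // q /eqd.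
rewrite inE => /eqP neq ->; rewrite -cnt_ind in neq.
have [f1 s1 q1] := codeP _ neq; split; first exact: stoimenow_cell_matching.
exact/QE.
Qed.

Lemma cnt_ext n d d' : (forall t, t < n -> d t = d' t) -> forall p, p <= n -> cnt d p = cnt d' p.
Proof.
move=> eqd p pn; apply: eq_bigr => q _; rewrite eqd //.
exact: leq_trans (ltn_ord q) pn.
Qed.

(** * Lists of cells determined by their breaks *)

Definition lexlt (x y : nat * nat) := (x.1 < y.1) || (x.1 == y.1) && (x.2 < y.2).

Definition ranges_over n (c : nat -> nat * nat) p (G : nat -> nat * nat) :=
  (forall t, t < n -> exists2 b, b < p & c t = G b) /\
  (forall b, b < p -> exists2 t, t < n & c t = G b).

Definition diag b : nat * nat := (b, b).

Lemma lexlt_mono p (G : nat -> nat * nat) : (forall b, b.+1 < p -> lexlt (G b) (G b.+1)) ->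
  forall a b, a < b -> b < p -> lexlt (G a) (G b).
Proof.
move=> incG a; elim=> // b IHb; rewrite ltnS leq_eqVlt => /predU1P[->|ab] bp; first exact: incG.
have := incG b bp; have := IHb ab (ltnW bp); rewrite /lexlt; lia.
Qed.

(** A sorted list with exactly the values of an increasing [G] runs through them in order and moves
    to the next one at each break. *)
Lemma ranges_over_breaks n c p G : 0 < n -> lexsorted n c -> ranges_over n c p G ->
  (forall b, b.+1 < p -> lexlt (G b) (G b.+1)) ->
  let brk t := (0 < t) && (c t != c t.-1) in
  p = (cnt brk n).+1 /\ forall t, t < n -> c t = G (cnt brk t.+1).
Proof.
move=> n0 sortc [cG Gc] /lexlt_mono incG brk.
have le_idx s t a b : s <= t -> t < n -> c s = G a -> c t = G b -> a < p -> b < p -> a <= b.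
  move=> st tn es et ap bp; rewrite leqNgt; apply/negP => ba.
  have := incG b a ba ap; rewrite -es -et /lexlt.
  case: (ltngtP s t) st => // [lt _|-> _]; last lia.
  by have := sortc s t lt tn; lia.
have main t : t < n -> cnt brk t.+1 < p /\ c t = G (cnt brk t.+1).
  elim: t => [_|t IHt tn].
    rewrite cntS cnt0 /=; have [b bp eb] := cG 0 n0; have p0 : 0 < p by lia.
    have [s sn es] := Gc 0 p0; split=> //.
    by have := @le_idx 0 s b 0 (leq0n _) sn eb es bp p0; rewrite leqn0 => /eqP b0; rewrite eb b0.
  have [lt eqt] := IHt (ltnW tn); have [b bp eb] := cG _ tn.
  have le1 := le_idx t t.+1 _ _ (leqnSn _) tn eqt eb lt bp.
  (* If the index jumped by 2 or more, the value in between would occur neither up to [t] nor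
     later. *)
  have le2 : b <= (cnt brk t.+1).+1.
    rewrite leqNgt; apply/negP => gt; have lt' : (cnt brk t.+1).+1 < p by lia.
    have [s sn es] := Gc _ lt'; case: (leqP s t) => st.
      by have := le_idx s t _ _ st (ltnW tn) es eqt lt' lt; lia.
    by have := le_idx t.+1 s _ _ st sn eb es bp lt'; lia.
  rewrite cntS {2 4}/brk /= eb eqt; case: (eqVneq (G b) (G (cnt brk t.+1))) => [eqG|neqG] /=.
    by rewrite addn0.
  have eqb : b = cnt brk t.+1 + 1; last by rewrite -eqb.
  case: (eqVneq b (cnt brk t.+1)) => [eqb|]; [by rewrite eqb eqxx in neqG|lia].
split=> [|t /main[]//].
have n1 : n.-1 < n by lia.
have [lt eqn] := main _ n1; rewrite prednK // in lt eqn.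
have p1 : p.-1 < p by lia.
have [s sn es] := Gc _ p1.
have := @le_idx s n.-1 _ _ ltac:(lia) n1 es eqn p1 lt; lia.
Qed.

Section BreakCoded.
Variables (n : nat) (L : nat -> nat -> nat * nat).

Definition diag_or_L c :=
  (exists p, ranges_over n c p diag) \/ (exists2 k, 1 < k & ranges_over n c k.+1 (L k)).

(* The breaks of the list of cells are the positive elements of [d], while
   [d 0] tells whether the cells are the diagonal ones or those given by [L]. *)
Definition break_code (d : nat -> bool) t :=
  if d 0 then diag (cnt d t.+1).-1 else L (cnt d n) (cnt d t.+1).

Hypothesis L00 : L 0 0 = (0, 0).
Hypothesis L_incr : forall k b, 1 < k -> b < k -> lexlt (L k b) (L k b.+1).
Hypothesis L_off_diag : forall k, 1 < k -> exists2 b, b <= k & (L k b).1 <> (L k b).2.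

Lemma diag_incr b : lexlt (diag b) (diag b.+1).
Proof. by rewrite /lexlt /=; lia. Qed.

Lemma break_code_ranges d : 0 < n ->
  if d 0 then ranges_over n (break_code d) (cnt d n) diag
  else ranges_over n (break_code d) (cnt d n).+1 (L (cnt d n)).
Proof.
move=> n0; rewrite /break_code; case d0 : (d 0); split.
- move=> t tn; exists (cnt d t.+1).-1 => //.
  have := cnt_mono d tn; have := @cnt_mono d 1 t.+1 isT; rewrite cntS cnt0 d0; lia.
- by move=> b /cnt_hit[t tn [dt eb]]; exists t => //; rewrite cntS dt eb addn1.
- by move=> t tn; exists (cnt d t.+1) => //; rewrite ltnS cnt_mono.
case=> [_|b]; first by exists 0 => //; rewrite cntS cnt0 d0.
by rewrite ltnS => /cnt_hit[t tn [dt eb]]; exists t => //; rewrite cntS dt eb addn1.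
Qed.

(** Here the singletons drop out: {0} would give the diagonal of size 1, already coded by the empty
    set through [L 0 0], and {t} with t > 0 would call for [L 1]. *)
Lemma break_code_diag_or_L d : cnt d n <> 1 -> diag_or_L (break_code d).
Proof.
move=> neq; case: (posnP n) => [n0|n0]; first by left; exists 0; split=> //; rewrite n0.
have := break_code_ranges d n0; case: ifP => d0 rg; first by left; exists (cnt d n).
case: (ltngtP (cnt d n) 1) => // [lt|gt]; last by right; exists (cnt d n).
left; exists 1; move: rg; rewrite (_ : cnt d n = 0); last lia.
have eq01 b : b < 1 -> L 0 b = diag b by case: b.
by case=> h1 h2; split=> [t /h1[b b1 ->]|b b1]; [exists b; rewrite ?eq01|rewrite -eq01 //; apply: h2].
Qed.

Lemma break_code_steps d t : cnt d n <> 1 -> t.+1 < n ->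
  lexlt (break_code d t) (break_code d t.+1) = d t.+1 /\
  (~~ d t.+1 -> break_code d t = break_code d t.+1).
Proof.
move=> neq tn; rewrite /break_code (cntS d t.+1); case dt : (d t.+1); last first.
  by rewrite addn0; split=> //; rewrite /lexlt; lia.
split=> //; rewrite addn1; case d0 : (d 0).
  have := @cnt_mono d 1 t.+1 isT; rewrite cntS cnt0 d0 add0n => lt.
  by rewrite /lexlt /=; lia.
have le := cnt_mono d tn; rewrite cntS dt addn1 in le.
apply: L_incr => //; lia.
Qed.

Lemma break_code_lexsorted d : cnt d n <> 1 -> lexsorted n (break_code d).
Proof.
move=> neq s; elim=> // t IHt; rewrite ltnS leq_eqVlt => lest tn.
have : (break_code d s).1 < (break_code d t).1 \/
   (break_code d s).1 = (break_code d t).1 /\ (break_code d s).2 <= (break_code d t).2.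
  by case/predU1P: lest => [->|lt]; [right|apply: IHt (ltnW tn)].
have [] := break_code_steps neq tn; case: (d t.+1) => [+ _|_ /(_ isT) -> //].
rewrite /lexlt; lia.
Qed.

Lemma break_code_inj d d' : cnt d n <> 1 -> cnt d' n <> 1 ->
  (forall t, t < n -> break_code d t = break_code d' t) -> forall t, t < n -> d t = d' t.
Proof.
move=> neq neq' eqc.
have eqS t : t.+1 < n -> d t.+1 = d' t.+1.
  move=> tn; have [<- _] := break_code_steps neq tn; have [<- _] := break_code_steps neq' tn.
  by rewrite !eqc // ltnW.
suff sep f g : cnt f n <> 1 -> cnt g n <> 1 -> (forall t, t < n -> break_code f t = break_code g t) ->
    (forall t, t.+1 < n -> f t.+1 = g t.+1) -> 0 < n -> f 0 -> ~~ g 0 -> False.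
  case=> [n0|t]; last exact: eqS.
  case d0 : (d 0); case d'0 : (d' 0) => //; exfalso.
    by apply: (sep d d'); rewrite ?d0 ?d'0.
  by apply: (sep d' d); rewrite ?d0 ?d'0 // => t tn; rewrite ?eqc ?eqS.
(* [f] has a second element, which is positive and shared with [g]. So [g] has at least two elements
   and its list contains an off-diagonal cell, unlike that of [f]. *)
move=> neqf neqg eqfg eqS' n0 f0 g0.
have f2 : 1 < cnt f n by have := cnt_mono f n0; rewrite cntS cnt0 f0; lia.
have [[|t] tn [ft ct]] := cnt_hit f2; first by rewrite cnt0 in ct.
have gt1 : 1 < cnt g n.
  have := cnt_mono g tn; rewrite cntS -eqS' // ft; lia.
have [b bk offd] := L_off_diag gt1.
have := break_code_ranges g n0; rewrite (negbTE g0) => -[_ /(_ b bk)[s sn es]].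
by apply: offd; rewrite -es -eqfg // /break_code f0.
Qed.

Lemma break_code_surj c : lexsorted n c -> diag_or_L c ->
  exists2 d, cnt d n <> 1 & forall t, t < n -> c t = break_code d t.
Proof.
move=> sortc; case: (posnP n) => [-> _|n0]; first by exists xpred0 => //; rewrite cnt0.
pose brk t := (0 < t) && (c t != c t.-1).
have cnt_flag f t : cnt (fun t => if t == 0 then f else brk t) t.+1 = f + cnt brk t.+1.
  elim: t => [|t IHt]; first by rewrite !cntS !cnt0 addnC.
  by rewrite cntS IHt (cntS brk t.+1) addnA.
have cnt_flag_n f : cnt (fun t => if t == 0 then f else brk t) n = f + cnt brk n.
  by case: (n) n0 => // n' _; apply: cnt_flag.
case=> [[p rg]|[k k1 rg]].
  have [|ep eqc] := ranges_over_breaks n0 sortc rg; first by move=> b _; apply: diag_incr.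
  (* Without breaks the list is constantly (0, 0), and its code is the empty set rather than {0}. *)
  rewrite -/brk in ep eqc; case: (posnP (cnt brk n)) => [brk0|brk0].
    exists (fun t => if t == 0 then false else brk t); first by rewrite cnt_flag_n brk0.
    move=> t tn; rewrite /break_code /= cnt_flag_n cnt_flag eqc //.
    have := cnt_mono brk tn; rewrite brk0 leqn0 => /eqP->.
    by rewrite L00.
  exists (fun t => if t == 0 then true else brk t); first by rewrite cnt_flag_n; lia.
  by move=> t tn; rewrite /break_code /= cnt_flag eqc.
have [|ep eqc] := ranges_over_breaks n0 sortc rg; first by move=> b bk; apply: L_incr => //; lia.
rewrite -/brk in ep eqc; case: ep => ep.
exists (fun t => if t == 0 then false else brk t); first by rewrite cnt_flag_n; lia.
by move=> t tn; rewrite /break_code /= cnt_flag_n cnt_flag eqc // -ep.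
Qed.

Lemma card_break_coded m (S : seq {set {set 'I_m.*2}}) (Q : (nat -> nat * nat) -> Prop) :
  (forall c, fishburn n c -> (all (avoids (cell_matching n c)) S <-> Q c)) ->
  (forall c, fishburn n c -> Q c -> diag_or_L c) ->
  (forall c, diag_or_L c -> fishburn n c /\ Q c) ->
  #|stoimenow_avoiders n S| = 2 ^ n - n.
Proof.
move=> QE Q_L L_Q; apply: (card_avoiders_coded (code := break_code) QE).
- move=> d neq; have [] := L_Q _ (break_code_diag_or_L neq).
  by split=> //; apply: break_code_lexsorted.
- move=> d d' eqd t tn; rewrite /break_code !(cnt_ext eqd) // eqd //.
  exact: leq_ltn_trans tn.
- exact: break_code_inj.
by move=> c fc sc Qc; apply: break_code_surj (Q_L c fc Qc).
Qed.

End BreakCoded.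

(** * The four classes *)

Lemma pairE (x : nat * nat) i j : x.1 = i -> x.2 = j -> x = (i, j).
Proof. by case: x => /= ? ? -> ->. Qed.

Lemma cell_dec n (c : nat -> nat * nat) x :
  (exists2 t, t < n & c t = x) \/ (forall t, t < n -> c t <> x).
Proof.
case: (boolP (has (fun t => c t == x) (iota 0 n))) => [/hasP[t]|/hasPn nx].
  by rewrite mem_iota => /= tn /eqP <-; left; exists t.
by right=> t tn; apply/eqP/nx; rewrite mem_iota.
Qed.

Lemma max_column n (c : nat -> nat * nat) : 0 < n ->
  exists2 N, forall t, t < n -> (c t).2 <= N & exists2 t, t < n & (c t).2 = N.
Proof.
elim: n => // n IHn _; case: (posnP n) => [->|/IHn[N leN [s sn es]]].
  by exists (c 0).2; [case|exists 0].
case: (leqP (c n).2 N) => [le|gt].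
  exists N; last by exists s; rewrite // ltnW.
  by move=> t; rewrite ltnS leq_eqVlt => /predU1P[->|/leN].
exists (c n).2; last by exists n.
move=> t; rewrite ltnS leq_eqVlt => /predU1P[->//|/leN]; lia.
Qed.

Lemma fishburn_ranges n c p G : ranges_over n c p G ->
  (forall b, b < p -> (G b).1 <= (G b).2) ->
  (forall b i, b < p -> i <= (G b).2 -> exists2 a, a < p & (G a).1 = i) ->
  (forall b j, b < p -> j <= (G b).2 -> exists2 a, a < p & (G a).2 = j) -> fishburn n c.
Proof.
move=> [cG Gc] le rows cols; split=> [t tn|t i tn|t j tn]; have [b bp ->] := cG t tn.
- exact: le.
- by case/(rows b i bp) => a /Gc[s sn es] <-; exists s; rewrite ?es.
by case/(cols b j bp) => a /Gc[s sn es] <-; exists s; rewrite ?es.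
Qed.

Section Classes.
Variables (n : nat) (c : nat -> nat * nat).

Lemma diag_fishburn p : ranges_over n c p diag ->
  fishburn n c /\ forall t, t < n -> (c t).1 = (c t).2.
Proof.
move=> rg; split; last by case: rg => cG _ t /cG[b _ ->].
by apply: (fishburn_ranges rg) => //= b i bp ib; exists i; rewrite // (leq_ltn_trans ib bp).
Qed.

Lemma diag_avoids p : ranges_over n c p diag ->
  fishburn n c /\ [/\ ~ cell_P1 n c, ~ cell_P2 n c, ~ cell_P4 n c & ~ cell_P5 n c].
Proof.
move=> rg; have [fc eqc] := diag_fishburn rg; split=> //; split.
- by case=> b [d [bn dn]]; rewrite !eqc //; lia.
- by case=> b [d [bn dn]]; rewrite !eqc //; lia.
- by case=> b [d [bn dn]]; rewrite !eqc //; lia.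
by case=> b [d [e [bn dn en]]]; rewrite !eqc //; lia.
Qed.

Hypothesis fishc : fishburn n c.

(** If (i, i) is missing, a cell of column [i] above it and a cell of row [i] to its right form
    [P2]. *)
Lemma diag_present t i : ~ cell_P2 n c -> t < n -> i <= (c t).2 -> exists2 s, s < n & c s = (i, i).
Proof.
move=> noP2 tn it; have [le rows cols] := fishc.
have [r rn er] := rows t i tn it; have [s sn es] := cols t i tn it.
have le_r := le r rn; have le_s := le s sn.
case: (eqVneq (c r).2 i) => [e|ne]; first by exists r => //; apply: pairE.
case: (eqVneq (c s).1 i) => [e|ne']; first by exists s => //; apply: pairE.
by case: noP2; exists s, r; split=> //; lia.
Qed.

(** A cell (i, j) with 0 < i < j forms [P4] with (i, i). *)
Lemma diag_below t : ~ cell_P2 n c -> ~ cell_P4 n c -> t < n -> 0 < (c t).1 ->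
  (c t).1 = (c t).2.
Proof.
move=> noP2 noP4 tn gt; have [le _ _] := fishc; have le_t := le t tn.
have [s sn es] := diag_present noP2 tn le_t.
case: (eqVneq (c t).1 (c t).2) => // ne.
by case: noP4; exists s, t; rewrite es; split=> //=; lia.
Qed.

End Classes.

(** * The three classes coded by breaks *)

Lemma all_avoids3 n (M : {set {set 'I_n.*2}}) (A B C : {set {set 'I_4.*2}}) (a b d : Prop) :
  (contains M A <-> a) -> (contains M B <-> b) -> (contains M C <-> d) ->
  (all (avoids M) [:: A; B; C] <-> [/\ ~ a, ~ b & ~ d]).
Proof.
move=> Aa Bb Cd; rewrite [all _ _]/= andbT /avoids.
split=> [/and3P[/negP hA /negP hB /negP hC]|[ha hb hd]].
  split=> h; [exact: hA (iffRL Aa h)|exact: hB (iffRL Bb h)|exact: hC (iffRL Cd h)].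
apply/and3P; split; apply/negP => h; [exact: ha (iffLR Aa h)|exact: hb (iffLR Bb h)|].
exact: hd (iffLR Cd h).
Qed.

Definition L124 (k b : nat) : nat * nat :=
  if b is b'.+1 then if b' is 0 then (0, 1) else (b', b') else (0, 0).

Lemma card_P124 n : #|stoimenow_avoiders n [:: P1; P2; P4]| = 2 ^ n - n.
Proof.
apply: (@card_break_coded n L124 _ _ _ _ _ (fun c => [/\ ~ cell_P1 n c, ~ cell_P2 n c & ~ cell_P4 n c])) => //.
- by move=> k [|[|b]] _ _; rewrite /lexlt /=; lia.
- by move=> k k1; exists 1; rewrite // ltnW.
- by move=> c fc; apply: all_avoids3 (contains_P1 fc) (contains_P2 fc) (contains_P4 fc).
- move=> c fc [noP1 noP2 noP4]; case: (posnP n) => [n0|n0].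
    by left; exists 0; rewrite n0; split.
  have [N leN [r rn er]] := max_column c n0; have [le rows cols] := fc.
  have dg i : i <= N -> exists2 s, s < n & c s = (i, i).
    by move=> iN; apply: (diag_present fc noP2 rn); rewrite er.
  have cells t : t < n -> (c t).1 = (c t).2 \/ c t = (0, 1).
    move=> tn; case: (posnP (c t).1) => [c0|]; last by left; apply: (diag_below fc).
    case: (ltngtP (c t).2 1) => [lt|gt|eq]; [left; lia| |right; exact: pairE].
    (* A cell (0, j) with j > 1 forms [P1] with (1, 1). *)
    have [s sn es] := dg 1 (leq_trans (ltnW gt) (leN t tn)).
    by case: noP1; exists t, s; rewrite es; split=> //=; lia.
  case: (cell_dec n c (0, 1)) => [[s sn es]|no01]; [right|left].
    have N1 : 0 < N by have := leN s sn; rewrite es.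
    (* [N] is the last index, so the matrix has size [N.+1]. *)
    exists N.+1 => //; split=> [t tn|[|[|b]] bN].
    + have leNt := leN t tn; case: (cells t tn) => [e|->]; last by exists 1.
      case ct : (c t).1 => [|i]; first by exists 0 => //; apply: pairE; lia.
      by exists i.+2; rewrite /=; [lia|apply: pairE; lia].
    + exact: dg.
    + by exists s.
    + by apply: dg; lia.
  exists N.+1; split=> [t tn|b bN]; last exact: dg.
  exists (c t).1; first by have := leN t tn; have := le t tn; lia.
  by case: (cells t tn) => [e|/(no01 t tn)//]; apply: pairE.
- move=> c; case=> [[p rg]|[k k1 rg]].
    by have [fc [? ? ? ?]] := diag_avoids rg; split.
  have fc : fishburn n c.
    apply: (fishburn_ranges rg) => [[|[|b]]|b i|b i] bk //=.
      move=> ib; case: i ib => [|i] ib; first by exists 0.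
      by exists i.+2 => //; case: b bk ib => [|[|b]] /=; lia.
    move=> ib; case: i ib => [|i] ib; first by exists 0.
    by exists i.+2 => //; case: b bk ib => [|[|b]] /=; lia.
  have cells t : t < n -> (c t).1 = (c t).2 \/ (c t).1 = 0 /\ (c t).2 = 1.
    by case: rg => cG _ /cG[[|[|b]] _ ->]; [left|right|left].
  have [le _ _] := fc; split=> //; split.
  + case=> x [y [xn yn ? ?]]; have := cells x xn; have := cells y yn.
    by have := le x xn; have := le y yn; lia.
  + by case=> x [y [xn yn ? ? ?]]; have := cells x xn; have := cells y yn; lia.
  by case=> x [y [xn yn ? ? ?]]; have := cells x xn; have := cells y yn; lia.
Qed.

Definition L245 (k b : nat) : nat * nat :=
  if b is b'.+1 then if b' is 0 then (0, k.-1) else (b', b') else (0, 0).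

Lemma card_P245 n : #|stoimenow_avoiders n [:: P2; P4; P5]| = 2 ^ n - n.
Proof.
apply: (@card_break_coded n L245 _ _ _ _ _ (fun c => [/\ ~ cell_P2 n c, ~ cell_P4 n c & ~ cell_P5 n c])) => //.
- by move=> k [|[|b]] k1 _; rewrite /lexlt /=; lia.
- by move=> k k1; exists 1; [rewrite ltnW|rewrite /=; lia].
- by move=> c fc; apply: all_avoids3 (contains_P2 fc) (contains_P4 fc) (contains_P5 fc).
- move=> c fc [noP2 noP4 noP5]; case: (posnP n) => [n0|n0].
    by left; exists 0; rewrite n0; split.
  have [N leN [r rn er]] := max_column c n0; have [le rows cols] := fc.
  have dg i : i <= N -> exists2 s, s < n & c s = (i, i).
    by move=> iN; apply: (diag_present fc noP2 rn); rewrite er.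
  have cells t : t < n -> (c t).1 = (c t).2 \/ c t = (0, N).
    move=> tn; case: (posnP (c t).1) => [c0|]; last by left; apply: (diag_below fc).
    case: (eqVneq (c t).2 N) => [eq|ne]; first by right; apply: pairE.
    case: (posnP (c t).2) => [eq|gt]; first by left; rewrite c0 eq.
    (* A cell (0, j) with 0 < j < N forms [P5] with (j, j) and (N, N). *)
    have leNt := leN t tn; have [s sn es] := dg _ leNt; have [u un eu] := dg N (leqnn _).
    by case: noP5; exists t, s, u; rewrite es eu /=; split=> //; lia.
  have diag_case : (forall t, t < n -> (c t).1 = (c t).2) -> diag_or_L n L245 c.
    move=> eqc; left; exists N.+1; split=> [t tn|b bN]; last exact: dg.
    by exists (c t).2; rewrite ?ltnS ?leN //; apply: pairE => //; apply: eqc.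
  case: (posnP N) => [N0|N0].
    by apply: diag_case => t tn; have := leN t tn; have := le t tn; lia.
  case: (cell_dec n c (0, N)) => [[s sn es]|noN]; last first.
    by apply: diag_case => t tn; case: (cells t tn) => [//|/(noN t tn)].
  right; exists N.+1 => //; split=> [t tn|[|[|b]] bN].
  + have leNt := leN t tn; case: (cells t tn) => [e|->]; last by exists 1.
    case ct : (c t).1 => [|i]; first by exists 0 => //; apply: pairE; lia.
    by exists i.+2; rewrite /=; [lia|apply: pairE; lia].
  + exact: dg.
  + by exists s.
  + by apply: dg; lia.
move=> c; case=> [[p rg]|[k k1 rg]].
  by have [fc [? ? ? ?]] := diag_avoids rg; split.
have fc : fishburn n c.
  apply: (fishburn_ranges rg) => [[|[|b]]|b i|b i] bk //=.
    move=> ib; case: i ib => [|i] ib; first by exists 0.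
    by exists i.+2 => //; case: b bk ib => [|[|b]] /=; lia.
  move=> ib; case: i ib => [|i] ib; first by exists 0.
  by exists i.+2 => //; case: b bk ib => [|[|b]] /=; lia.
have cells t : t < n -> (c t).2 < k /\ ((c t).1 = (c t).2 \/ (c t).1 = 0 /\ (c t).2 = k.-1).
  by case: rg => cG _ /cG[[|[|b]] bk ->] /=; lia.
have [le _ _] := fc; split=> //; split.
- by case=> x [y [xn yn ? ? ?]]; have := cells x xn; have := cells y yn; lia.
- by case=> x [y [xn yn ? ? ?]]; have := cells x xn; have := cells y yn; lia.
case=> x [y [z [xn yn zn ? ?]]]; have := cells x xn; have := cells y yn; have := cells z zn.
by have := le z zn; lia.
Qed.

(** With last index N, [k = 2N] gives the first row and the last column with their corner (0, N),
    and [k = 2N - 1] the same without the corner. For [k = 1] this is the diagonal (0, 0), (1,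
    1). *)
Definition L145 (k b : nat) : nat * nat :=
  if b <= k./2 then (0, b) else (b - k./2, k.+1./2).

Lemma card_P145 n : #|stoimenow_avoiders n [:: P1; P4; P5]| = 2 ^ n - n.
Proof.
apply: (@card_break_coded n L145 _ _ _ _ _ (fun c => [/\ ~ cell_P1 n c, ~ cell_P4 n c & ~ cell_P5 n c])) => //.
- move=> k b k1 bk; rewrite /lexlt /L145.
  by case: (leqP b k./2); case: (leqP b.+1 k./2) => /=; lia.
- by move=> k k1; exists 1; rewrite /L145; [lia|rewrite ifT //; lia].
- by move=> c fc; apply: all_avoids3 (contains_P1 fc) (contains_P4 fc) (contains_P5 fc).
- move=> c fc [noP1 noP4 noP5]; case: (posnP n) => [n0|n0].
    by left; exists 0; rewrite n0; split.
  have [N leN [r rn er]] := max_column c n0; have [le rows cols] := fc.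
  have row i : i <= N -> exists2 s, s < n & (c s).1 = i.
    by move=> iN; apply: (rows r) => //; rewrite er.
  have [u un eu] := row N (leqnn _).
  (* A cell (i, j) with 0 < i < j < N and a cell of row j form [P4] if the latter is in column N;
     otherwise they form [P5] with the cell of row N. *)
  have row_pos t : t < n -> 0 < (c t).1 -> (c t).1 = (c t).2 \/ (c t).2 = N.
    move=> tn gt; have leNt := leN t tn; have [s sn es] := row _ leNt.
    have le_t := le t tn; have le_s := le s sn; have leNs := leN s sn.
    case: (eqVneq (c t).1 (c t).2) => [|ne1]; first by left.
    case: (eqVneq (c t).2 N) => [|ne2]; first by right.
    case: (eqVneq (c s).2 N) => [eN|ne3].
      by case: noP4; exists t, s; split=> //; lia.
    by case: noP5; exists t, s, u; split=> //; lia.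
  have diag_case : (forall t, t < n -> (c t).1 = (c t).2) -> diag_or_L n L145 c.
    move=> eqc; left; exists N.+1; split=> [t tn|b bN].
      by exists (c t).2; rewrite ?ltnS ?leN //; apply: pairE => //; apply: eqc.
    by have [s sn es] := row b bN; exists s => //; apply: pairE; rewrite -?eqc.
  case: (posnP N) => [N0|N0].
    by apply: diag_case => t tn; have := leN t tn; have := le t tn; lia.
  (* If (1, 1) is missing, row 1 contains (1, N), which forms [P1] with any (i, i), 1 < i < N. *)
  have [[[s sn es] N1]|rowsN] : (exists2 s, s < n & c s = (1, 1)) /\ 1 < N \/
     (forall t, t < n -> 0 < (c t).1 -> (c t).2 = N).
  - case: (cell_dec n c (1, 1)) => [s1|no11].
      case: (ltnP 1 N) => N1; first by left.
      by right=> t tn gt; have := le t tn; have := leN t tn; lia.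
    right=> t tn gt; case: (row_pos t tn gt) => // eqt.
    have [s sn es] := row 1 N0; have leNt := leN t tn.
    case: (row_pos s sn) => [|e|e]; first by rewrite es.
      by case: (no11 s sn); apply: pairE; rewrite -?e.
    case: (eqVneq (c t).1 1) => [e1|ne1]; first by case: (no11 t tn); apply: pairE; rewrite -?eqt.
    case: (eqVneq (c t).2 N) => // neN.
    by case: noP1; exists s, t; split=> //; lia.
  (* With (1, 1), a cell (0, j) gives [P1] if j > 1 and [P5] if j = 1. So for 0 < i < N column i
     contains only (i, i), which forms [P4] with any (i, N). *)
  - apply: diag_case => t tn; have le_t := le t tn; have leNt := leN t tn.
    case: (posnP (c t).1) => [c0|gt].
      case: (ltngtP (c t).2 1) => [|gt1|eq1]; first by lia.
        by case: noP1; exists t, s; rewrite es; split=> //=; lia.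
      by case: noP5; exists t, s, u; rewrite es; split=> //=; lia.
    case: (row_pos t tn gt) => // eN; case: (ltnP (c t).1 N) => ltN; last by lia.
    have [v vn ev] := cols t (c t).1 tn le_t; have le_v := le v vn.
    case: (posnP (c v).1) => [v0|gtv].
      case: (ltnP 1 (c v).2) => ltv.
        by case: noP1; exists v, s; rewrite es; split=> //=; lia.
      by case: noP5; exists v, s, u; rewrite es; split=> //=; lia.
    case: (row_pos v vn gtv) => [eqv|eqv]; last by lia.
    by case: noP4; exists v, t; split=> //; lia.
  (* The columns before the last one can only be filled from the first row. *)
  have col0 j : j < N -> exists2 t, t < n & c t = (0, j).
    move=> jN; have [t tn et] := cols r j rn ltac:(lia); exists t => //.
    apply: pairE => //; case: (posnP (c t).1) => // gt.
    by have := rowsN t tn gt; lia.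
  have hook k : 1 < k -> k.+1./2 = N -> (forall t, t < n -> (c t).1 = 0 -> (c t).2 <= k./2) ->
      (forall j, j <= k./2 -> exists2 t, t < n & c t = (0, j)) -> diag_or_L n L145 c.
    move=> k1 kN row0 row0'; right; exists k => //; rewrite /L145; split=> [t tn|b bk].
      case: (posnP (c t).1) => [c0|gt].
        have le0 := row0 t tn c0; exists (c t).2; first by lia.
        by rewrite le0; apply: pairE.
      have eN := rowsN t tn gt; have := le t tn => le_t.
      exists ((c t).1 + k./2); first by lia.
      by rewrite ifF ?addnK ?kN; [apply: pairE|lia].
    case: ifP => bk2; first exact: row0'.
    have [t tn et] := row (b - k./2) ltac:(lia); exists t => //; apply: pairE => //.
    by rewrite kN; apply: rowsN => //; lia.
  case: (cell_dec n c (0, N)) => [corner|no_corner].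
    apply: (hook N.*2); rewrite ?doubleK; try by lia.
      by move=> t tn _; apply: leN.
    by move=> j; rewrite leq_eqVlt => /predU1P[->|/col0].
  have ltN t : t < n -> (c t).1 = 0 -> (c t).2 < N.
    move=> tn c0; rewrite ltn_neqAle leN // andbT; apply/eqP => eN.
    by case: (no_corner t tn); apply: pairE.
  case: (ltnP 1 N) => N1.
    apply: (hook N.*2.-1); try by lia.
      by move=> t tn c0; have := ltN t tn c0; lia.
    by move=> j jN; apply: col0; lia.
  (* For N = 1 the hook without its corner is the diagonal. *)
  apply: diag_case => t tn; case: (posnP (c t).1) => [c0|gt].
    by have := ltN t tn c0; lia.
  by have := rowsN t tn gt; have := le t tn; lia.
move=> c; case=> [[p rg]|[k k1 rg]].
  by have [fc [? ? ? ?]] := diag_avoids rg; split.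
have fc : fishburn n c.
  apply: (fishburn_ranges rg) => [b|b i|b i]; rewrite /L145 => bk.
  - by case: ifP => /=; lia.
  - move=> ib; have {}ib : i <= k.+1./2 by case: ifP ib => /=; lia.
    case: i ib => [|i] ib; first by exists 0.
    by exists (i.+1 + k./2); [lia|rewrite ifF ?addnK //; lia].
  move=> ib; have {}ib : i <= k.+1./2 by case: ifP ib => /=; lia.
  case: (leqP i k./2) => ik; first by exists i; [lia|rewrite ik].
  by exists k => //; rewrite ifF /=; lia.
have cells t : t < n -> (c t).1 = 0 /\ (c t).2 <= k.+1./2 \/
    0 < (c t).1 <= k.+1./2 /\ (c t).2 = k.+1./2.
  by case: rg => cG _ /cG[b bk ->]; rewrite /L145; case: ifP => /=; lia.
have [le _ _] := fc; split=> //; split.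
- by case=> x [y [xn yn ? ?]]; have := cells x xn; have := cells y yn; lia.
- by case=> x [y [xn yn ? ? ?]]; have := cells x xn; have := cells y yn; lia.
case=> x [y [z [xn yn zn ? ?]]]; have := cells x xn; have := cells y yn; have := cells z zn.
by lia.
Qed.

(** * The class avoiding [P2], [P3] and [P5] *)

Section P235.
Variable n : nat.
Implicit Types d : nat -> bool.

(* The cells are the [(i, i)], [i < k], and copies of the [(i, k - 1)], where
   the [(i, i)] with [0 < i < k - 1] occur once. The element number [i] of [d]
   is the position of the last [(0, 0)] if [i = 0], and of the first [(i, i)]
   otherwise. *)
Definition code235 (d : nat -> bool) t :=
  let b := cnt d t in
  if d t then (b, b) else if b is b'.+1 then (b', (cnt d n).-1) else (0, 0).

Lemma code235_true d t : d t -> code235 d t = (cnt d t, cnt d t).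
Proof. by rewrite /code235 => ->. Qed.

Lemma code235_false d t : ~~ d t -> (code235 d t).1 = (cnt d t).-1 /\
  (code235 d t).2 = if cnt d t == 0 then 0 else (cnt d n).-1.
Proof. by rewrite /code235 => /negbTE->; case: (cnt d t). Qed.

Lemma cnt_lt d t : t < n -> cnt d t + d t <= cnt d n.
Proof. by move=> tn; rewrite -cntS; apply: cnt_mono. Qed.

Lemma code235_bounds d t : t < n ->
  [/\ (code235 d t).1 <= (code235 d t).2, (code235 d t).2 <= (cnt d n).-1 &
      (code235 d t).2 < (cnt d n).-1 -> (code235 d t).1 = (code235 d t).2].
Proof.
move=> tn; have := cnt_lt d tn; case dt : (d t).
  by rewrite code235_true //=; split=> //; lia.
have [-> ->] := code235_false (negbT dt).
by case: eqVneq => [->|] /=; split=> //; lia.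
Qed.

Lemma code235_fishburn d : fishburn n (code235 d).
Proof.
have hit t i : t < n -> i <= (code235 d t).2 -> exists2 s, s < n & code235 d s = (i, i).
  move=> tn; have [_ le _] := code235_bounds d tn => ile.
  case: (ltnP i (cnt d n)) => [/cnt_hit[s sn [ds <-]]|ge].
    by exists s => //; rewrite code235_true.
  (* Here [d] is empty below [n], and all cells are (0, 0). *)
  have d0 : cnt d t = 0 by have := cnt_lt d tn; lia.
  exists t => //; case dt : (d t); first by have := cnt_lt d tn; rewrite dt; lia.
  by have := code235_false (negbT dt); rewrite d0 /= => -[e1 e2]; apply: pairE; lia.
split=> [t tn|t i tn ile|t j tn jle]; first by have [] := code235_bounds d tn.
  by have [s sn es] := hit t i tn ile; exists s; rewrite ?es.
by have [s sn es] := hit t j tn jle; exists s; rewrite ?es.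
Qed.

Lemma code235_lexsorted d : lexsorted n (code235 d).
Proof.
move=> s t st tn; have := cnt_mono d st; rewrite cntS => lest.
have let_ := cnt_lt d tn; have sn := ltn_trans st tn.
case ds : (d s) lest; case dt : (d t) let_ => let_ lest.
- by rewrite !code235_true //=; lia.
- rewrite (code235_true ds) /=; have [-> ->] := code235_false (negbT dt).
  by case: eqVneq; lia.
- rewrite (code235_true dt) /=; have [-> ->] := code235_false (negbT ds).
  by case: eqVneq; lia.
have [-> ->] := code235_false (negbT ds); have [-> ->] := code235_false (negbT dt).
by case: (eqVneq (cnt d s) 0) => ?; case: (eqVneq (cnt d t) 0) => ?; lia.
Qed.

Lemma code235_middle d t i : t < n -> code235 d t = (i, i) -> 0 < i < (cnt d n).-1 ->
  d t /\ cnt d t = i.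
Proof.
move=> tn et ilt; case dt : (d t).
  by move: et; rewrite code235_true // => -[].
have := code235_false (negbT dt); rewrite et /=; case: eqVneq; lia.
Qed.

(** Cells outside the last column are diagonal, which excludes [P2] and [P5]. An occurrence of [P3]
    would need two arcs in one middle diagonal cell, but these cells are simple by
    [code235_middle]. *)
Lemma code235_avoids d :
  [/\ ~ cell_P2 n (code235 d), ~ cell_P3 n (code235 d) & ~ cell_P5 n (code235 d)].
Proof.
split.
- case=> x [y [xn yn ? ? ?]].
  by have [? ? ?] := code235_bounds d xn; have [? ? ?] := code235_bounds d yn; lia.
- case=> x [y [z [u [[xn yn zn un] neq ? ? [? ? ?]]]]].
  have [le_y lek_y eq_y] := code235_bounds d yn; have [le_z lek_z eq_z] := code235_bounds d zn.
  have [le_u lek_u eq_u] := code235_bounds d un.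
  have ey : code235 d y = ((code235 d z).1, (code235 d z).1) by apply: pairE; lia.
  have ez : code235 d z = ((code235 d z).1, (code235 d z).1) by apply: pairE; lia.
  have [|dy cy] := code235_middle yn ey; first by lia.
  have [|dz cz] := code235_middle zn ez; first by lia.
  case: (ltngtP y z) => // lt; have := cnt_mono d lt; rewrite cntS ?dy ?dz; lia.
case=> x [y [z [xn yn zn ? [? ?]]]].
have [? ? ?] := code235_bounds d xn; have [? ? ?] := code235_bounds d yn.
by have [? ? ?] := code235_bounds d zn; lia.
Qed.

Lemma code235_ext d d' : (forall t, t < n -> d t = d' t) ->
  forall t, t < n -> code235 d t = code235 d' t.
Proof.
by move=> eqd t tn; rewrite /code235 eqd // !(cnt_ext eqd) // ltnW.
Qed.

(** If only [d] contains [t], both counts are 0 there: [d] has its last (0, 0) at [t], while [d']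
    continues with (0, 0). As [d] is not a singleton, position [t.+1] exists and tells the lists
    apart. *)
Lemma code235_sep d d' t : cnt d n <> 1 -> t < n -> code235 d t = code235 d' t ->
  (t.+1 < n -> code235 d t.+1 = code235 d' t.+1) -> cnt d t = cnt d' t -> d t -> d' t.
Proof.
move=> neq tn eqt eqt1 eqc dt; case d't : (d' t) => //.
have [e1 e2] := code235_false (negbT d't); move: e1 e2; rewrite -eqt code235_true //= -eqc => e1 _.
have c0 : cnt d t = 0 by lia.
have lt := cnt_lt d tn; rewrite dt c0 in lt.
have tn1 : t.+1 < n.
  rewrite ltn_neqAle tn andbT; apply/eqP => tn1.
  by apply: neq; rewrite -tn1 cntS c0 dt.
have c1 : cnt d t.+1 = 1 by rewrite cntS c0 dt.
have c1' : cnt d' t.+1 = 0 by rewrite cntS -eqc c0 d't.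
have {eqt1} := eqt1 tn1; rewrite {2}/code235 c1' if_same /code235 c1.
by case: (d t.+1) => // -[]; lia.
Qed.

Lemma code235_inj d d' : cnt d n <> 1 -> cnt d' n <> 1 ->
  (forall t, t < n -> code235 d t = code235 d' t) -> forall t, t < n -> d t = d' t.
Proof.
move=> neq neq' eqc; elim/ltn_ind=> t IHt tn.
have eqcnt : cnt d t = cnt d' t.
  by apply: (@cnt_ext t) => // q qt; apply: IHt => //; apply: ltn_trans tn.
apply/idP/idP; apply: code235_sep => //; try (by apply: eqc); try (by move=> ?; apply: eqc);
  by [apply/esym/eqc|move=> ?; apply/esym/eqc].
Qed.

Lemma code235_surj c : fishburn n c -> lexsorted n c ->
  ~ cell_P2 n c -> ~ cell_P3 n c -> ~ cell_P5 n c ->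
  exists2 d, cnt d n <> 1 & forall t, t < n -> c t = code235 d t.
Proof.
move=> fc sortc noP2 noP3 noP5; case: (posnP n) => [n0|n0].
  by exists xpred0 => [|t]; rewrite n0 ?cnt0.
have [N leN [r rn er]] := max_column c n0; have [le rows cols] := fc.
have dg i : i <= N -> exists2 s, s < n & c s = (i, i).
  by move=> iN; apply: (diag_present fc noP2 rn); rewrite er.
have le_sorted s t : s <= t -> t < n -> (c s).1 < (c t).1 \/ (c s).1 = (c t).1 /\ (c s).2 <= (c t).2.
  by rewrite leq_eqVlt => /predU1P[->|]; [right|apply: sortc].
case: (posnP N) => [N0|N0].
  have c0 : cnt xpred0 =1 fun=> 0 by move=> p; apply: big1.
  exists xpred0 => [|t tn]; rewrite /code235 ?c0 //=.
  by apply: pairE; have := leN t tn; have := le t tn; lia.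
have cells t : t < n -> (c t).1 = (c t).2 \/ (c t).2 = N.
  move=> tn; have leNt := leN t tn; have le_t := le t tn.
  case: (eqVneq (c t).2 N) => [|ne]; [by right|left].
  have [s sn es] := dg _ leNt; have [u un eu] := dg N (leqnn _).
  case: (eqVneq (c t).1 (c t).2) => // ne'.
  by case: noP5; exists t, s, u; rewrite es eu /=; split=> //; lia.
(* Two copies of a middle diagonal cell form [P3] with (0, 0) and (N, N). *)
have uniq_middle s t : s < t -> t < n -> c s = c t -> (c t).1 = (c t).2 -> 0 < (c t).1 < N -> False.
  move=> st tn est eqt ilt; have [s0 s0n es0] := dg 0 (leq0n _); have [u un eu] := dg N (leqnn _).
  apply: noP3; exists s0, s, t, u; rewrite est es0 eu eqt /=; split; try lia.
    by split=> //; apply: ltn_trans tn.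
  by split; lia.
pose z t := ((c t).1 == 0) && ((c t).2 == 0).
(* The elements are the position of the last (0, 0) and that of the first copy of each other
   diagonal cell. *)
pose d t := z t && ~~ z t.+1 || ~~ z t && ((c t).1 == (c t).2) &&
  ~~ (((c t).1 == (c t.-1).1) && ((c t).2 == (c t.-1).2)).
(* Rows are entered one at a time, each at its diagonal cell, which is present and least in its
   row. *)
have next t : t.+1 < n -> (c t.+1).1 = (c t).1 \/
    (c t.+1).1 = (c t).1.+1 /\ (c t.+1).2 = (c t).1.+1.
  move=> tn; have tn' := ltnW tn; have lt := le_sorted t t.+1 (leqnSn _) tn.
  case: (ltngtP (c t).1 (c t.+1).1) lt => [lt _|gt|->]; [|lia|by left]; right.
  have leN1 := leN _ tn; have le1 := le _ tn.
  have [s sn es] := dg (c t).1.+1 ltac:(lia).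
  case: (leqP s t) => st; first by have := le_sorted s t st tn'; rewrite es /=; lia.
  by have := le_sorted t.+1 s st sn; rewrite es /=; lia.
(* Invariant of the scan: [cnt d t] is 0 on the cells (0, 0); afterwards it is the row at an element
   of [d], and the row plus 1 at the other cells, all in the last column. *)
have inv t : t < n -> z t /\ cnt d t = 0 \/
    ~~ z t /\ (d t /\ cnt d t = (c t).1 /\ (c t).2 = (c t).1 \/
               ~~ d t /\ cnt d t = (c t).1.+1 /\ (c t).2 = N).
  elim: t => [_|t IHt tn].
    left; rewrite cnt0; split=> //; have [s sn es] := dg 0 (leq0n _).
    by have := le_sorted 0 s (leq0n _) sn; have := le 0 n0; rewrite es /z /=; lia.
  have tn' := ltnW tn; have nx := next t tn; have srt := le_sorted t t.+1 (leqnSn _) tn.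
  have cl := cells t.+1 tn; have cl' := cells t tn'; have le1 := le _ tn.
  have un : c t = c t.+1 -> (c t.+1).1 = (c t.+1).2 -> 0 < (c t.+1).1 < N -> False.
    exact: uniq_middle.
  have {}un : (c t).1 = (c t.+1).1 -> (c t).2 = (c t.+1).2 ->
      (c t.+1).1 = (c t.+1).2 -> 0 < (c t.+1).1 < N -> False.
    by move=> e1 e2; apply: un; case: (c t) (c t.+1) e1 e2 => ? ? [? ?] /= -> ->.
  have leN1 := leN _ tn; have leN2 := leN _ tn'.
  rewrite cntS; case: (IHt tn') => [[zt ->]|[nzt IH]].
    case zt1 : (z t.+1); [left|right].
      by split=> //; rewrite /d zt zt1.
    split=> //; have -> : d t by rewrite /d zt zt1.
    have c0 : (c t).1 = 0 by move: zt; rewrite /z; lia.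
    case: nx => [e1|[e1 e2]]; [right|left].
      have eN : (c t.+1).2 = N by move: zt1; rewrite /z; lia.
      by rewrite /d zt1 e1 c0 eN; split; lia.
    by rewrite /d zt1 /= e1 e2 c0.
  have -> : cnt d t + d t = (c t).1.+1.
    by case: IH => [[-> [-> _]]|[/negbTE-> [-> _]]]; lia.
  have nzt1 : ~~ z t.+1 by move: nzt; rewrite /z; case: nx => [e1|[e1 e2]]; lia.
  right; split=> //; case: nx => [e1|[e1 e2]]; [right|left]; last first.
    by rewrite /d nzt1 (negbTE nzt1) /= e1 e2; split; lia.
  have eN : (c t.+1).2 = N by move: nzt; rewrite /z; case: IH => -[_ [_ eq]]; lia.
  by rewrite /d (negbTE nzt1) /= e1 eN; split=> //; case: IH => -[_ [_ eq]]; lia.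
have n1 : n.-1 < n by lia.
have [u un eu] := dg N (leqnn _).
have eN : (c n.-1).1 = N /\ (c n.-1).2 = N.
  have := le_sorted u n.-1 ltac:(lia) n1; have := leN _ n1; have := le _ n1.
  by rewrite eu /=; lia.
have cntn : cnt d n = N.+1.
  rewrite -(prednK n0) cntS; case: (inv _ n1) => [[zn _]|[_ [[dn [-> _]]|[dn [-> _]]]]].
  - by move: zn; rewrite /z; lia.
  - by rewrite dn; lia.
  by rewrite (negbTE dn); lia.
exists d => [|t tn]; first by lia.
case: (inv t tn) => [[zt c0]|[nzt [[dt [ct et]]|[dt [ct et]]]]].
- rewrite /code235 c0 if_same; move: zt; rewrite /z => /andP[/eqP e1 /eqP e2].
  exact: pairE.
- by rewrite code235_true // ct; apply: pairE.
by rewrite /code235 (negbTE dt) ct cntn; apply: pairE.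
Qed.

Lemma card_P235 : #|stoimenow_avoiders n [:: P2; P3; P5]| = 2 ^ n - n.
Proof.
apply: (@card_avoiders_coded n _ _
  (fun c => [/\ ~ cell_P2 n c, ~ cell_P3 n c & ~ cell_P5 n c]) code235).
- by move=> c fc; apply: all_avoids3 (contains_P2 fc) (contains_P3 fc) (contains_P5 fc).
- move=> d _; split; [exact: code235_fishburn|exact: code235_lexsorted|exact: code235_avoids].
- exact: code235_ext.
- exact: code235_inj.
by move=> c fc sc []; apply: code235_surj.
Qed.

End P235.

(** * The two mirror-image classes *)

Lemma perm_pattern m (s s' : seq (nat * nat)) : perm_eq s s' -> pattern m s = pattern m s'.
Proof. by move=> ss'; apply/setP => B; rewrite !inE; apply/perm_mem/perm_map. Qed.

Lemma rev_pattern m s : all (fun e => (0 < e.1 <= m.*2) && (0 < e.2 <= m.*2)) s ->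
  rev_matching (pattern m s) = pattern m [seq (m.*2.+1 - e.2, m.*2.+1 - e.1) | e <- s].
Proof.
move=> /allP ranges; apply/setP => B.
have revE e : e \in s ->
    (@rev_ord _) @: [set x : 'I_m.*2 | (x.+1 == e.1) || (x.+1 == e.2)] =
    [set x : 'I_m.*2 | (x.+1 == m.*2.+1 - e.2) || (x.+1 == m.*2.+1 - e.1)].
  move=> /ranges e_range; apply/setP => x; rewrite -[x]rev_ordK mem_imset; last exact: rev_ord_inj.
  by rewrite !inE /=; have := ltn_ord x; lia.
rewrite inE -map_comp; apply/imsetP/mapP => [[A]|[e es ->]].
  by rewrite inE => /mapP[e es ->] ->; exists e; rewrite // revE.
exists [set x : 'I_m.*2 | (x.+1 == e.1) || (x.+1 == e.2)]; last by rewrite revE.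
by rewrite inE; apply/mapP; exists e.
Qed.

Lemma rev_P1 : rev_matching P1 = P1.
Proof. by rewrite rev_pattern //; apply: perm_pattern. Qed.

Lemma rev_P2 : rev_matching P2 = P2.
Proof. by rewrite rev_pattern //; apply: perm_pattern. Qed.

Lemma rev_P3 : rev_matching P3 = P3.
Proof. by rewrite rev_pattern //; apply: perm_pattern. Qed.

Lemma rev_P4 : rev_matching P4 = P5.
Proof. by rewrite rev_pattern //; apply: perm_pattern. Qed.

Lemma rev_P5 : rev_matching P5 = P4.
Proof. by rewrite -rev_P4 rev_matchingK. Qed.

(** Reversal fixes [P1] and [P2] and exchanges [P4] and [P5]. *)
Lemma card_P125 n : #|stoimenow_avoiders n [:: P1; P2; P5]| = 2 ^ n - n.
Proof.
rewrite -(card_P124 n) -[RHS]card_avoiders_rev; first by rewrite /= rev_P1 rev_P2 rev_P4.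
by rewrite /= P1E P2E P4E !card_word_pattern.
Qed.

Lemma card_P234 n : #|stoimenow_avoiders n [:: P2; P3; P4]| = 2 ^ n - n.
Proof.
rewrite -(card_P235 n) -[RHS]card_avoiders_rev; first by rewrite /= rev_P2 rev_P3 rev_P5.
by rewrite /= P2E P3E P5E !card_word_pattern.
Qed.

(** * The common generating function *)

Local Open Scope ring_scope.

Theorem theorem4p2 (S : seq {set {set 'I_(4.*2)}}) :
  S \in [:: [:: P1; P2; P4]; [:: P1; P2; P5]; [:: P2; P3; P4];
            [:: P2; P3; P5]; [:: P1; P4; P5]; [:: P2; P4; P5]] ->
  avoiders_gf S =1
  fps_div (fps_of_poly (1 - 3%:R *: 'X + 3%:R *: 'X^2))
          (fps_of_poly ((1 - 'X) ^+ 2 * (1 - 2%:R *: 'X))).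
Proof.
rewrite !inE => S_in n; rewrite fps_div_coef /avoiders_gf; congr _%:R.
by case/or4P: S_in => [||| /or3P[]] /eqP->; [exact: card_P124|exact: card_P125|exact: card_P234|
  exact: card_P235|exact: card_P145|exact: card_P245].
Qed.
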